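(* Let $k$ be a field, let $P$ be a poset and let $Q\subseteq P$ be an interior system of $P$. Then the following hold. (1) There is an adjoint pair $\operatorname{Cont}_Q\dashv \operatorname{Ind}_Q$, where $\operatorname{Cont}_Q\colon \operatorname{Rep}P\to\operatorname{Rep}Q$ is left adjoint to $\operatorname{Ind}_Q\colon\operatorname{Rep}Q\to\operatorname{Rep}P$. (2) $\operatorname{Cont}_Q\circ\operatorname{Ind}_Q\simeq \operatorname{id}_{\operatorname{Rep}Q}$. (3) $\operatorname{Cont}_Q$ is right exact and $\operatorname{Ind}_Q$ is exact. (4) $\operatorname{Cont}_Q$ preserves projectives, and it also preserves indecomposable projectives. (5) The adjoint pair in (1) restricts to an adjoint pair $\operatorname{Cont}_Q\dashv\operatorname{Ind}_Q$ between the categories of finitely presentable persistence modules, with $\operatorname{Cont}_Q\colon\operatorname{fprep}P\to\operatorname{fprep}Q$ and $\operatorname{Ind}_Q\colon\operatorname{fprep}Q\to\operatorname{fprep}P$.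
   Context: A poset $P$ is regarded as a category with a unique morphism $a\to b$ iff $a\le b$. A $P$-persistence module is a functor from $P$ to the category of (not necessarily finite-dimensional) $k$-vector spaces; $\operatorname{Rep}P$ is the category of these with natural transformations. For a subset $S\subseteq P$ (with the induced order), $M|_S$ denotes the restriction of $M$ to $S$, and $\operatorname{colim}$ denotes the colimit of a persistence module regarded as a diagram of vector spaces. For $a\in P$, let $a^{\uparrow}=\{x\in P: a\le x\}$ and let $\mathbb I_{a^\uparrow}$ be the module with value $k$ on $a^\uparrow$, $0$ elsewhere, and identity maps between the copies of $k$ (these are, up to isomorphism, the indecomposable projectives of $\operatorname{Rep}P$). A module is finitely presentable if it is isomorphic to the cokernel of a morphism $\bigoplus_{b\in\mathcal J}\mathbb I_{b^\uparrow}\to\bigoplus_{a\in\mathcal I}\mathbb I_{a^\uparrow}$ with $\mathcal I,\mathcal J$ finite multisets of elements of $P$; $\operatorname{fprep}P$ is the full subcategory of finitely presentable modules. A full subposet $Q\subseteq P$ is an interior system of $P$ if the inclusion $Q\hookrightarrow P$ has a right adjoint, i.e. for every $x\in P$ the maximum $\lfloor x\rfloor_Q:=\max\{y\in Q: y\le x\}$ exists. The induction functor $\operatorname{Ind}_Q\colon\operatorname{Rep}Q\to\operatorname{Rep}P$ is the left Kan extension along the inclusion $Q\hookrightarrow P$; for an interior system it is naturally isomorphic to the pullback along $\lfloor\ \rfloor_Q$, i.e. $\operatorname{Ind}_QM(a)=M(\lfloor a\rfloor_Q)$ and $\operatorname{Ind}_QM(a\le b)=M(\lfloor a\rfloor_Q\le\lfloor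 b\rfloor_Q)$. The contraction functor $\operatorname{Cont}_Q\colon\operatorname{Rep}P\to\operatorname{Rep}Q$ is the left Kan extension along the order-preserving map $\lfloor\ \rfloor_Q\colon P\to Q$, i.e. $\operatorname{Cont}_QM(x)=\operatorname{colim}\big(M|_{\{a\in P:\lfloor a\rfloor_Q\le x\}}\big)$ for $x\in Q$, with the structure maps, and the action on morphisms, induced by the universal property of colimits. *)

(* Defs.v *)
From HB Require Import structures.
From mathcomp Require Import all_boot all_order all_algebra.
From mathcomp Require Import boolp.

Set Implicit Arguments.
Unset Strict Implicit.
Unset Printing Implicit Defensive.

Import Order.TTheory GRing.Theory.
Local Open Scope ring_scope.

Record category := Category {
  ob :> Type;
  mor : ob -> ob -> Type;
  idm : forall a, mor a a;
  mcomp : forall a b c, mor b c -> mor a b -> mor a c;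
  mcomp_idl : forall a b (f : mor a b), mcomp (idm b) f = f;
  mcomp_idr : forall a b (f : mor a b), mcomp f (idm a) = f;
  mcompA : forall a b c e (h : mor c e) (g : mor b c) (f : mor a b),
    mcomp h (mcomp g f) = mcomp (mcomp h g) f }.

Arguments mor {c} _ _ : rename.
Arguments idm {c} a : rename.
Arguments mcomp {c0 a b c} _ _ : rename.

Section CategoryTheory.
Variable C : category.

Definition is_iso (a b : C) (f : mor a b) : Prop :=
  exists g : mor b a, mcomp g f = idm a /\ mcomp f g = idm b.

Definition isomorphic (a b : C) : Prop := exists f : mor a b, is_iso f.

Definition is_epi (a b : C) (f : mor a b) : Prop :=
  forall (c : C) (g h : mor b c), mcomp g f = mcomp h f -> g = h.

Definition projective (p : C) : Prop :=
  forall (a b : C) (e : mor a b) (f : mor p b),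
    is_epi e -> exists g : mor p a, mcomp e g = f.

Definition full_subcategory (X : C -> Prop) : category :=
  @Category {a : C | X a} (fun a b => mor (sval a) (sval b))
    (fun a => idm (sval a)) (fun a b c g f => mcomp g f)
    (fun a b f => mcomp_idl f) (fun a b f => mcomp_idr f)
    (fun a b c e h g f => mcompA h g f).

End CategoryTheory.

Record functor (C D : category) := Functor {
  fobj :> C -> D;
  fmap : forall a b : C, mor a b -> mor (fobj a) (fobj b);
  fmap_id : forall a, fmap (idm a) = idm (fobj a);
  fmap_comp : forall a b c (g : mor b c) (f : mor a b),
    fmap (mcomp g f) = mcomp (fmap g) (fmap f) }.

Arguments fmap {C D} f {a b} _ : rename.

Definition id_functor (C : category) : functor C C :=
  @Functor C C id (fun _ _ f => f) (fun _ => erefl) (fun _ _ _ _ _ => erefl).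

Section FunctorComp.
Variables (C D E : category) (G : functor D E) (F : functor C D).

Lemma comp_functor_id (a : C) : fmap G (fmap F (idm a)) = idm (G (F a)).
Proof. by rewrite !fmap_id. Qed.

Lemma comp_functor_comp (a b c : C) (g : mor b c) (f : mor a b) :
  fmap G (fmap F (mcomp g f)) =
  mcomp (fmap G (fmap F g)) (fmap G (fmap F f)).
Proof. by rewrite !fmap_comp. Qed.

Definition comp_functor : functor C E :=
  Functor comp_functor_id comp_functor_comp.

End FunctorComp.

Definition naturally_isomorphic (C D : category) (F G : functor C D) : Prop :=
  exists eta : forall a, mor (F a) (G a),
    (forall a b (f : mor a b),
       mcomp (eta b) (fmap F f) = mcomp (fmap G f) (eta a)) /\
    (forall a, is_iso (eta a)).

(* [adjunction F G] is the data of F being left adjoint to G. *)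
Record adjunction (C D : category) (F : functor C D) (G : functor D C) :=
  Adjunction {
    transpose : forall (c : C) (x : D), mor (F c) x -> mor c (G x);
    transpose_bij : forall c x, bijective (@transpose c x);
    transpose_natl : forall (c c' : C) (x : D) (g : mor (F c) x)
      (f : mor c' c), transpose (mcomp g (fmap F f)) = mcomp (transpose g) f;
    transpose_natr : forall (c : C) (x x' : D) (h : mor x x')
      (g : mor (F c) x), transpose (mcomp h g) = mcomp (fmap G h) (transpose g) }.

Section RestrictFunctor.
Variables (C D : category) (X : C -> Prop) (Y : D -> Prop) (F : functor C D).
Hypothesis XY : forall a, X a -> Y (F a).

Definition restrict_functor :
    functor (full_subcategory X) (full_subcategory Y) :=
  @Functor (full_subcategory X) (full_subcategory Y)
    (fun a => exist Y (F (sval a)) (XY (svalP a)))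
    (fun a b f => fmap F f)
    (fun a => fmap_id F (sval a)) (fun a b c g f => fmap_comp F g f).

End RestrictFunctor.

Record pmod (k : fieldType) d (S : porderType d) := Pmod {
  pmod_ob :> S -> lmodType k;
  pmod_map : forall x y, (x <= y)%O -> {linear pmod_ob x -> pmod_ob y};
  pmod_id : forall x (le_xx : (x <= x)%O) v, pmod_map le_xx v = v;
  pmod_comp : forall x y z (le_xy : (x <= y)%O) (le_yz : (y <= z)%O)
    (le_xz : (x <= z)%O) v,
    pmod_map le_yz (pmod_map le_xy v) = pmod_map le_xz v }.

Arguments pmod_map {k d S} M {x y} le_xy : rename.

Record pmod_hom (k : fieldType) d (S : porderType d) (M N : pmod k S) :=
  PmodHom {
    hom_at :> forall x, {linear M x -> N x};
    hom_nat : forall x y (le_xy : (x <= y)%O) v,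
      hom_at y (pmod_map M le_xy v) = pmod_map N le_xy (hom_at x v) }.

Lemma linear_ext (k : fieldType) (U V : lmodType k) (f g : {linear U -> V}) :
  f =1 g -> f = g.
Proof.
case: f => f [[fa] [fb]]; case: g => g [[ga] [gb]] /= /funext fg.
case: _ / fg in ga gb *.
by rewrite (Prop_irrelevance fa ga) (Prop_irrelevance fb gb).
Qed.

Section RepCategory.
Variables (k : fieldType) (d : Order.disp_t) (S : porderType d).
Implicit Types M N : pmod k S.

Lemma pmod_hom_ext M N (f g : pmod_hom M N) :
  (forall x, f x =1 g x) -> f = g.
Proof.
case: f => f fn; case: g => g gn /= fg.
have e : f = g by apply: functional_extensionality_dep => x; apply/linear_ext/fg.
by case: _ / e in gn {fg} *; rewrite (Prop_irrelevance fn gn).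
Qed.

Definition pmod_idm M : pmod_hom M M :=
  @PmodHom k d S M M (fun x => idfun) (fun _ _ _ _ => erefl).

Section Comp.
Variables (M N L : pmod k S) (g : pmod_hom N L) (f : pmod_hom M N).

Lemma pmod_compm_nat x y (le_xy : (x <= y)%O) v :
  g y (f y (pmod_map M le_xy v)) = pmod_map L le_xy (g x (f x v)).
Proof. by rewrite !hom_nat. Qed.

Definition pmod_compm : pmod_hom M L :=
  @PmodHom k d S M L (fun x => g x \o f x) pmod_compm_nat.

End Comp.

Lemma pmod_comp_idl M N (f : pmod_hom M N) : pmod_compm (pmod_idm N) f = f.
Proof. exact: pmod_hom_ext. Qed.

Lemma pmod_comp_idr M N (f : pmod_hom M N) : pmod_compm f (pmod_idm M) = f.
Proof. exact: pmod_hom_ext. Qed.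

Lemma pmod_compmA M N L K
    (h : pmod_hom L K) (g : pmod_hom N L) (f : pmod_hom M N) :
  pmod_compm h (pmod_compm g f) = pmod_compm (pmod_compm h g) f.
Proof. exact: pmod_hom_ext. Qed.

End RepCategory.

Definition Rep (k : fieldType) d (S : porderType d) : category :=
  Category (@pmod_comp_idl k d S) (@pmod_comp_idr k d S) (@pmod_compmA k d S).

Section RepNotions.
Variables (k : fieldType) (d : Order.disp_t) (S : porderType d).
Implicit Types M N L : Rep k S.

Section Add.
Variables (M N : Rep k S) (f g : mor M N).

Lemma pmod_addm_nat x y (le_xy : (x <= y)%O) v :
  f y (pmod_map M le_xy v) + g y (pmod_map M le_xy v) =
  pmod_map N le_xy (f x v + g x v).
Proof. by rewrite !hom_nat linearD. Qed.

Definition pmod_addm : mor M N :=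
  @PmodHom k d S M N (fun x => f x \+ g x) pmod_addm_nat.

End Add.

Definition zero_hom M N : mor M N :=
  @PmodHom k d S M N (fun x => \0) (fun _ _ le_xy _ =>
    esym (raddf0 (pmod_map N le_xy))).

Definition zero_pmod : Rep k S :=
  @Pmod k d S (fun _ => 'rV[k]_0) (fun _ _ _ => idfun)
    (fun _ _ _ => erefl) (fun _ _ _ _ _ _ _ => erefl).

Definition is_zero M : Prop := forall x (v : M x), v = 0.

Section DirectSum.
Variables M N : Rep k S.

Definition dsum_map x y (le_xy : (x <= y)%O) (v : (M x * N x)%type) :
    (M y * N y)%type := (pmod_map M le_xy v.1, pmod_map N le_xy v.2).

Lemma dsum_map_linear x y (le_xy : (x <= y)%O) : linear (dsum_map le_xy).
Proof. by move=> a u v; rewrite /dsum_map /= !linearP. Qed.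

HB.instance Definition _ x y (le_xy : (x <= y)%O) :=
  GRing.isLinear.Build k (M x * N x)%type (M y * N y)%type _
    (dsum_map le_xy) (dsum_map_linear le_xy).

Lemma dsum_map_id x (le_xx : (x <= x)%O) v : dsum_map le_xx v = v.
Proof. by case: v => u v; rewrite /dsum_map !pmod_id. Qed.

Lemma dsum_map_comp x y z (le_xy : (x <= y)%O) (le_yz : (y <= z)%O)
    (le_xz : (x <= z)%O) v :
  dsum_map le_yz (dsum_map le_xy v) = dsum_map le_xz v.
Proof. by rewrite /dsum_map !(pmod_comp _ _ le_xz). Qed.

Definition dsum : Rep k S :=
  @Pmod k d S (fun x => (M x * N x)%type)
    (fun x y le_xy => dsum_map le_xy) dsum_map_id dsum_map_comp.

End DirectSum.

Definition indecomposable M : Prop :=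
  ~ is_zero M /\
  forall A B : Rep k S, isomorphic M (dsum A B) -> is_zero A \/ is_zero B.

Definition exact_at M N L (f : mor M N) (g : mor N L) : Prop :=
  forall x (v : N x), g x v = 0 <-> exists u : M x, f x u = v.

Definition pointwise_inj M N (f : mor M N) : Prop :=
  forall x, injective (f x).

Definition pointwise_surj M N (f : mor M N) : Prop :=
  forall x (w : N x), exists v, f x v = w.

Definition short_exact M N L (f : mor M N) (g : mor N L) : Prop :=
  [/\ pointwise_inj f, exact_at f g & pointwise_surj g].

Definition is_cokernel M N L (f : mor M N) (g : mor N L) : Prop :=
  mcomp g f = zero_hom M L /\
  forall (K : Rep k S) (h : mor N K), mcomp h f = zero_hom M K ->
    exists! u : mor L K, mcomp u g = h.

End RepNotions.

Section ExactFunctors.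
Variables (k : fieldType) (d d' : Order.disp_t).
Variables (S : porderType d) (T : porderType d').
Variable F : functor (Rep k S) (Rep k T).

Definition additive_functor : Prop :=
  forall (M N : Rep k S) (f g : mor M N),
    fmap F (pmod_addm f g) = pmod_addm (fmap F f) (fmap F g).

Definition right_exact : Prop :=
  additive_functor /\
  forall (M N L : Rep k S) (f : mor M N) (g : mor N L), short_exact f g ->
    exact_at (fmap F f) (fmap F g) /\ pointwise_surj (fmap F g).

Definition exact_functor : Prop :=
  additive_functor /\
  forall (M N L : Rep k S) (f : mor M N) (g : mor N L), short_exact f g ->
    short_exact (fmap F f) (fmap F g).

End ExactFunctors.

Section Upset.
Variables (k : fieldType) (d : Order.disp_t) (S : porderType d).

Definition line_if (b : bool) : lmodType k :=
  if b then (k^o : lmodType k) else 'rV[k]_0.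

Definition line_if_map (b c : bool) : {linear line_if b -> line_if c} :=
  match b, c return {linear line_if b -> line_if c} with
  | true, true => idfun
  | _, _ => \0
  end.

Lemma line_if_map_id b (v : line_if b) : line_if_map b b v = v.
Proof. by case: b v => //= v; rewrite [RHS]thinmx0. Qed.

Lemma line_if_map_comp b1 b2 b3 : (b1 ==> b2) -> (b2 ==> b3) ->
  forall v, line_if_map b2 b3 (line_if_map b1 b2 v) = line_if_map b1 b3 v.
Proof. by case: b1 b2 b3 => [] [] []. Qed.

Variable a : S.

Lemma upset_imply x y : (x <= y)%O -> (a <= x)%O ==> (a <= y)%O.
Proof. by move=> le_xy; apply/implyP => /le_trans; apply. Qed.

Definition upset_pmod : Rep k S :=
  @Pmod k d S (fun x => line_if (a <= x)%O)
    (fun x y _ => line_if_map (a <= x)%O (a <= y)%O)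
    (fun x _ v => line_if_map_id v)
    (fun x y z le_xy le_yz _ v =>
       line_if_map_comp (upset_imply le_xy) (upset_imply le_yz) v).

End Upset.

(* The finite multiset of points is encoded by a list. *)
Definition upset_sum (k : fieldType) d (S : porderType d) (I : seq S) :
    Rep k S :=
  foldr (fun a M => dsum (upset_pmod k a) M) (zero_pmod k S) I.

Definition finitely_presentable (k : fieldType) d (S : porderType d)
    (M : Rep k S) : Prop :=
  exists (I J : seq S) (f : mor (upset_sum k J) (upset_sum k I))
    (g : mor (upset_sum k I) M), is_cokernel f g.

Definition fprep (k : fieldType) d (S : porderType d) : category :=
  full_subcategory (@finitely_presentable k d S).

Definition subposet d (S : porderType d) (A : {pred S}) := {x : S | x \in A}.

HB.instance Definition _ d (S : porderType d) (A : {pred S}) :=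
  SubChoice.copy (subposet A) {x : S | x \in A}.
HB.instance Definition _ d (S : porderType d) (A : {pred S}) :=
  [SubChoice_isSubPOrder of subposet A by <: with d].

Definition restrict (k : fieldType) d (S : porderType d) (M : Rep k S)
    (A : {pred S}) : Rep k (subposet A) :=
  @Pmod k d (subposet A) (fun x => M (val x))
    (fun x y (le_xy : (x <= y)%O) => pmod_map M (le_xy : (val x <= val y)%O))
    (fun x => @pmod_id k d S M (val x))
    (fun x y z => @pmod_comp k d S M (val x) (val y) (val z)).

(* The colimit of M is the space of formal finite sums of elements of the
   spaces M a, modulo the congruence generated by the vector space structures
   of the M a and by the identification of v with its images under the
   structure maps. Lists encode formal sums, so that [++] is addition. The
   universal property is [colim_desc_in] and [colim_ext] below. *)

Section Colim.
Variables (k : fieldType) (d : Order.disp_t) (S : porderType d).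
Variable M : Rep k S.

Definition formal_sum : Type := seq {a : S & M a}.

HB.instance Definition _ := Choice.on formal_sum.

Definition elt a (v : M a) : {a : S & M a} := existT (fun a => M a : Type) a v.

Inductive colim_eq : formal_sum -> formal_sum -> Prop :=
| colim_eq_refl s : colim_eq s s
| colim_eq_sym s t : colim_eq s t -> colim_eq t s
| colim_eq_trans s t u : colim_eq s t -> colim_eq t u -> colim_eq s u
| colim_eq_cat s s' t t' :
    colim_eq s s' -> colim_eq t t' -> colim_eq (s ++ t) (s' ++ t')
| colim_eq_comm s t : colim_eq (s ++ t) (t ++ s)
| colim_eq_zero a : colim_eq [:: elt (0 : M a)] [::]
| colim_eq_add a (v w : M a) : colim_eq [:: elt (v + w)] [:: elt v; elt w]
| colim_eq_map a b (le_ab : (a <= b)%O) (v : M a) :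
    colim_eq [:: elt (pmod_map M le_ab v)] [:: elt v].

Definition colim_eqb : rel formal_sum := fun s t => `[< colim_eq s t >].

Lemma colim_eqb_equiv : equiv_class_of colim_eqb.
Proof.
split=> [s|s t|t s u]; rewrite /colim_eqb.
- by apply/asboolP; constructor.
- by apply/asbool_equiv_eq; split; constructor.
- move=> /asboolP st /asboolP tu; apply/asboolP.
  exact: colim_eq_trans st tu.
Qed.

Canonical colim_equiv := EquivRelPack colim_eqb_equiv.

Definition colim : Type := {eq_quot colim_equiv}%qT.

HB.instance Definition _ := Choice.on colim.
HB.instance Definition _ := EqQuotient.on colim.

Definition class_of_sum (s : formal_sum) : colim := \pi_colim%qT s.

Lemma class_eq s t : class_of_sum s = class_of_sum t <-> colim_eq s t.
Proof.
rewrite /class_of_sum; split.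
  by move=> /eqP; rewrite eqmodE => /asboolP.
by move=> st; apply/eqP; rewrite eqmodE; apply/asboolP.
Qed.

Lemma colim_ind (X : colim -> Prop) :
  (forall s, X (class_of_sum s)) -> forall q, X q.
Proof. by move=> Xs; elim/quotW. Qed.

Lemma repr_class s : colim_eq (repr (class_of_sum s)) s.
Proof. by apply/class_eq; rewrite /class_of_sum reprK. Qed.

Definition formal_scale (c : k) (s : formal_sum) : formal_sum :=
  [seq elt (c *: (tagged u : M (tag u))) | u : {a : S & M a} <- s].

Definition colim_zero : colim := class_of_sum [::].
Definition colim_add (p q : colim) : colim := class_of_sum (repr p ++ repr q).
Definition colim_scale (c : k) (q : colim) : colim :=
  class_of_sum (formal_scale c (repr q)).
Definition colim_opp (q : colim) : colim := colim_scale (-1) q.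

Lemma formal_scale_eq c s t :
  colim_eq s t -> colim_eq (formal_scale c s) (formal_scale c t).
Proof.
elim=> {s t} [s|s t _|s t u _ IH _|s s' t t' _ IH _ IH'|s t|a|a v w|a b le_ab v].
- exact: colim_eq_refl.
- exact: colim_eq_sym.
- exact: colim_eq_trans IH.
- by rewrite /formal_scale !map_cat; apply: colim_eq_cat.
- by rewrite /formal_scale !map_cat; apply: colim_eq_comm.
- by rewrite /formal_scale /= scaler0; apply: colim_eq_zero.
- by rewrite /formal_scale /= scalerDr; apply: colim_eq_add.
- by rewrite /formal_scale /= -linearZ; apply: colim_eq_map.
Qed.

Lemma colim_addE s t :
  colim_add (class_of_sum s) (class_of_sum t) = class_of_sum (s ++ t).
Proof. by apply/class_eq/colim_eq_cat; apply: repr_class. Qed.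

Lemma colim_scaleE c s :
  colim_scale c (class_of_sum s) = class_of_sum (formal_scale c s).
Proof. by apply/class_eq/formal_scale_eq/repr_class. Qed.

Lemma colim_addA : associative colim_add.
Proof.
elim/colim_ind=> s; elim/colim_ind=> t; elim/colim_ind=> u.
by rewrite !colim_addE catA.
Qed.

Lemma colim_addC : commutative colim_add.
Proof.
elim/colim_ind=> s; elim/colim_ind=> t.
by rewrite !colim_addE; apply/class_eq/colim_eq_comm.
Qed.

Lemma colim_add0 : left_id colim_zero colim_add.
Proof. by elim/colim_ind=> s; rewrite colim_addE. Qed.

Lemma colim_scaleDl c c' q :
  colim_scale (c + c') q = colim_add (colim_scale c q) (colim_scale c' q).
Proof.
elim/colim_ind: q => s; rewrite !colim_scaleE colim_addE; apply/class_eq.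
elim: s => [|[a v] s IH]; first exact: colim_eq_refl.
rewrite /formal_scale /= scalerDl.
apply: (@colim_eq_trans _ ([:: elt (c *: v); elt (c' *: v)] ++
  (formal_scale c s ++ formal_scale c' s))).
  by rewrite -cat1s; apply: colim_eq_cat IH; apply: colim_eq_add.
set A := formal_scale c s; set B := formal_scale c' s.
suff : colim_eq ([:: elt (c *: v)] ++ ([:: elt (c' *: v)] ++ A) ++ B)
  ([:: elt (c *: v)] ++ (A ++ [:: elt (c' *: v)]) ++ B) by rewrite -!catA.
apply/colim_eq_cat/colim_eq_cat; try exact: colim_eq_refl.
exact: colim_eq_comm.
Qed.

Lemma colim_scale0 q : colim_scale 0 q = colim_zero.
Proof.
elim/colim_ind: q => s; rewrite colim_scaleE; apply/class_eq.
elim: s => [|[a v] s IH]; first exact: colim_eq_refl.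
rewrite /formal_scale /= scale0r -cat1s -[X in colim_eq _ X]cat0s.
exact: colim_eq_cat (colim_eq_zero a) IH.
Qed.

Lemma colim_scale1 : left_id 1 colim_scale.
Proof.
elim/colim_ind=> s; rewrite colim_scaleE; congr class_of_sum.
by elim: s => //= [[a v] s IH]; rewrite /formal_scale /= scale1r; congr cons.
Qed.

Lemma colim_addN : left_inverse colim_zero colim_opp colim_add.
Proof.
move=> q; rewrite -{2}[q]colim_scale1 /colim_opp -colim_scaleDl addNr.
exact: colim_scale0.
Qed.

HB.instance Definition _ :=
  GRing.isZmodule.Build colim colim_addA colim_addC colim_add0 colim_addN.

Lemma colim_scaleA c c' q :
  colim_scale c (colim_scale c' q) = colim_scale (c * c') q.
Proof.
elim/colim_ind: q => s; rewrite !colim_scaleE; congr class_of_sum.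
rewrite /formal_scale -map_comp; apply: eq_map => u /=.
by rewrite scalerA.
Qed.

Lemma colim_scaleDr : right_distributive colim_scale +%R.
Proof.
move=> c; elim/colim_ind=> s; elim/colim_ind=> t.
by rewrite [_ + _]colim_addE !colim_scaleE [RHS]colim_addE /formal_scale map_cat.
Qed.

Lemma colim_scaleDl' q : {morph colim_scale^~ q : c c' / c + c'}.
Proof. by move=> c c'; apply: colim_scaleDl. Qed.

HB.instance Definition _ :=
  GRing.Zmodule_isLmodule.Build k colim
    colim_scaleA colim_scale1 colim_scaleDr colim_scaleDl'.

Section Injection.
Variable a : S.

Definition colim_in (v : M a) : colim := class_of_sum [:: elt v].

Lemma colim_in_linear : linear colim_in.
Proof.
move=> c v w; rewrite [c *: colim_in v]colim_scaleE [RHS]colim_addE.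
by apply/class_eq/colim_eq_add.
Qed.

HB.instance Definition _ :=
  GRing.isLinear.Build k (M a) colim _ colim_in colim_in_linear.

End Injection.

Lemma colim_in_map a b (le_ab : (a <= b)%O) (v : M a) :
  colim_in (pmod_map M le_ab v) = colim_in v.
Proof. by apply/class_eq/colim_eq_map. Qed.

Lemma class_of_sumE s :
  class_of_sum s = \sum_(u <- s) colim_in (tagged u : M (tag u)).
Proof.
elim: s => [|[a v] s IH]; first by rewrite big_nil.
by rewrite big_cons -IH [RHS]colim_addE.
Qed.

Lemma colim_ext (V : lmodType k) (f g : {linear colim -> V}) :
  (forall a (v : M a), f (colim_in v) = g (colim_in v)) -> f =1 g.
Proof.
move=> fg; elim/colim_ind=> s; rewrite class_of_sumE !linear_sum.
by apply: eq_bigr => u _.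
Qed.

Section Descent.
Variable V : lmodType k.
Variable c : forall a, {linear M a -> V}.
Hypothesis c_cocone :
  forall a b (le_ab : (a <= b)%O) v, c b (pmod_map M le_ab v) = c a v.

Definition formal_eval (s : formal_sum) : V := \sum_(u <- s) c (tag u) (tagged u).

Lemma formal_eval_eq s t : colim_eq s t -> formal_eval s = formal_eval t.
Proof.
elim=> {s t} [s|s t _ ->|s t u _ -> _ ->|s s' t t' _ IH _ IH'|s t|a|a v w|a b le_ab v] //.
- by rewrite /formal_eval !big_cat; congr (_ + _).
- by rewrite /formal_eval !big_cat /= addrC.
- by rewrite /formal_eval big_seq1 big_nil linear0.
- by rewrite /formal_eval !big_cons !big_nil !addr0 linearD.
- by rewrite /formal_eval !big_seq1 c_cocone.
Qed.

(* The unused argument is there for the linear structure to be inferred. *)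
Definition colim_desc_fun (_ : forall a b (le_ab : (a <= b)%O) v,
    c b (pmod_map M le_ab v) = c a v) (q : colim) : V := formal_eval (repr q).

Lemma colim_desc_funE s :
  colim_desc_fun c_cocone (class_of_sum s) = formal_eval s.
Proof. exact/formal_eval_eq/repr_class. Qed.

Lemma colim_desc_linear : linear (colim_desc_fun c_cocone).
Proof.
move=> x; elim/colim_ind=> s; elim/colim_ind=> t.
rewrite [_ *: _]colim_scaleE [_ + _]colim_addE !colim_desc_funE.
rewrite /formal_eval big_cat /= big_map scaler_sumr; congr (_ + _).
by apply: eq_bigr => u _; rewrite linearZ.
Qed.

HB.instance Definition _ :=
  GRing.isLinear.Build k colim V _ (colim_desc_fun c_cocone) colim_desc_linear.

Definition colim_desc : {linear colim -> V} := colim_desc_fun c_cocone.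

Lemma colim_desc_in a (v : M a) : colim_desc (colim_in v) = c a v.
Proof. by rewrite /= colim_desc_funE /formal_eval big_seq1. Qed.

End Descent.
End Colim.

(* [lan f] is the pointwise left Kan extension along f:
   (lan f M) x = colim (M restricted to {a | f a <= x}).
   The formula makes sense for any f, but it is a Kan extension only for
   order-preserving f; it is used below for [val] and [floor]. *)

Section Lan.
Variables (k : fieldType) (d d' : Order.disp_t).
Variables (S : porderType d) (T : porderType d') (f : S -> T).

Definition down_fiber (x : T) : {pred S} := [pred a | (f a <= x)%O].

Section LanObject.
Variable M : Rep k S.

Definition lan_at (x : T) : lmodType k := colim (restrict M (down_fiber x)).

Definition lan_in x a (fa : a \in down_fiber x) : {linear M a -> lan_at x} :=
  let i : subposet (down_fiber x) := exist _ a fa in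
  (@colim_in k d _ (restrict M (down_fiber x)) i :
     {linear restrict M (down_fiber x) i -> colim (restrict M (down_fiber x))}).

Lemma lan_in_map x a b (fa : a \in down_fiber x) (fb : b \in down_fiber x)
  (le_ab : (a <= b)%O) v : lan_in fb (pmod_map M le_ab v) = lan_in fa v.
Proof.
exact: (@colim_in_map k d _ (restrict M (down_fiber x))
  (exist _ a fa) (exist _ b fb) le_ab v).
Qed.

Lemma lan_ext x (V : lmodType k) (g h : {linear lan_at x -> V}) :
  (forall a (fa : a \in down_fiber x) v, g (lan_in fa v) = h (lan_in fa v)) ->
  g =1 h.
Proof. by move=> gh; apply: colim_ext => -[a fa] v; apply: gh. Qed.

Lemma down_fiberS x y a :
  (x <= y)%O -> a \in down_fiber x -> a \in down_fiber y.
Proof. by rewrite !inE => le_xy /le_trans; apply. Qed.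

Definition lan_cocone x y (le_xy : (x <= y)%O) (a : subposet (down_fiber x)) :
    {linear M (val a) -> lan_at y} :=
  lan_in (down_fiberS le_xy (valP a)).

Lemma lan_coconeP x y (le_xy : (x <= y)%O) (a b : subposet (down_fiber x))
    (le_ab : (a <= b)%O) v :
  lan_cocone le_xy b (pmod_map (restrict M (down_fiber x)) le_ab v) =
  lan_cocone le_xy a v.
Proof. exact: lan_in_map. Qed.

Definition lan_map x y (le_xy : (x <= y)%O) : {linear lan_at x -> lan_at y} :=
  colim_desc (@lan_coconeP x y le_xy).

Lemma lan_map_in x y (le_xy : (x <= y)%O) a (fx : a \in down_fiber x)
  (fy : a \in down_fiber y) v : lan_map le_xy (lan_in fx v) = lan_in fy v.
Proof.
rewrite /lan_map [LHS]colim_desc_in /lan_cocone /=.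
by rewrite (bool_irrelevance (down_fiberS _ _) fy).
Qed.

Lemma lan_map_id x (le_xx : (x <= x)%O) v : lan_map le_xx v = v.
Proof.
by apply: (lan_ext (h := idfun)) => a fa w; apply: lan_map_in.
Qed.

Lemma lan_map_comp x y z (le_xy : (x <= y)%O) (le_yz : (y <= z)%O)
  (le_xz : (x <= z)%O) v : lan_map le_yz (lan_map le_xy v) = lan_map le_xz v.
Proof.
apply: (lan_ext (g := lan_map le_yz \o lan_map le_xy)) => a fx w /=.
have fy := down_fiberS le_xy fx; have fz := down_fiberS le_yz fy.
by rewrite !(lan_map_in _ _ fy, lan_map_in _ _ fz).
Qed.

Definition lan_ob : Rep k T := @Pmod k d' T lan_at lan_map lan_map_id lan_map_comp.

End LanObject.

Section LanMorphism.
Variables (M N : Rep k S) (h : mor M N).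

Definition lan_hom_cocone x (a : subposet (down_fiber x)) :
    {linear M (val a) -> lan_at N x} := lan_in N (valP a) \o h (val a).

Lemma lan_hom_coconeP x (a b : subposet (down_fiber x)) (le_ab : (a <= b)%O) v :
  lan_hom_cocone b (pmod_map (restrict M (down_fiber x)) le_ab v) =
  lan_hom_cocone a v.
Proof. by rewrite /lan_hom_cocone /= hom_nat (lan_in_map (valP a)). Qed.

Definition lan_hom_at x : {linear lan_at M x -> lan_at N x} :=
  colim_desc (@lan_hom_coconeP x).

Lemma lan_hom_at_in x a (fa : a \in down_fiber x) v :
  lan_hom_at x (lan_in M fa v) = lan_in N fa (h a v).
Proof.
rewrite /lan_hom_at [LHS]colim_desc_in /=.
by congr (lan_in N _ _); apply: bool_irrelevance.
Qed.

Lemma lan_hom_nat x y (le_xy : (x <= y)%O) v :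
  lan_hom_at y (lan_map M le_xy v) = lan_map N le_xy (lan_hom_at x v).
Proof.
apply: (lan_ext (g := lan_hom_at y \o lan_map M le_xy)
  (h := lan_map N le_xy \o lan_hom_at x)) => a fx w /=.
have fy := down_fiberS le_xy fx.
by rewrite lan_hom_at_in !(lan_map_in _ _ fy) lan_hom_at_in.
Qed.

Definition lan_hom : mor (lan_ob M) (lan_ob N) :=
  @PmodHom k d' T (lan_ob M) (lan_ob N) lan_hom_at lan_hom_nat.

End LanMorphism.

Lemma lan_hom_id (M : Rep k S) : lan_hom (idm M) = idm (lan_ob M).
Proof.
apply: pmod_hom_ext => x; apply: lan_ext => a fa v.
exact: lan_hom_at_in.
Qed.

Lemma lan_hom_comp (M N L : Rep k S) (h : mor N L) (g : mor M N) :
  lan_hom (mcomp h g) = mcomp (lan_hom h) (lan_hom g).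
Proof.
apply: pmod_hom_ext => x; apply: lan_ext => a fa v /=.
by rewrite !lan_hom_at_in.
Qed.

Definition lan : functor (Rep k S) (Rep k T) := Functor lan_hom_id lan_hom_comp.

End Lan.

Section InteriorSystem.
Variables (d : Order.disp_t) (P : porderType d) (Q : {pred P}).

Definition is_floor (x y : P) : Prop :=
  [/\ y \in Q, (y <= x)%O & forall z, z \in Q -> (z <= x)%O -> (z <= y)%O].

Definition interior_system : Prop := forall x, exists y, is_floor x y.

Hypothesis intQ : interior_system.

Definition floor (x : P) : subposet Q :=
  let: exist y fl_y := cid (intQ x) in
  let: And3 yQ _ _ := fl_y in exist _ y yQ.

Lemma floorP x : is_floor x (val (floor x)).
Proof. by rewrite /floor; case: (cid _) => y [yQ le_yx max_y]; split. Qed.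

Lemma floor_homo : {homo floor : x y / (x <= y)%O}.
Proof.
move=> x y le_xy; have [fQ fx _] := floorP x; have [_ _ max_fy] := floorP y.
exact: max_fy fQ (le_trans fx le_xy).
Qed.

Definition Ind (k : fieldType) : functor (Rep k (subposet Q)) (Rep k P) :=
  lan k (fun y : subposet Q => val y).

Definition Cont (k : fieldType) : functor (Rep k P) (Rep k (subposet Q)) :=
  lan k floor.

End InteriorSystem.

(* Main.v *)
From HB Require Import structures.
Require Import Defs.
From mathcomp Require Import all_boot all_order all_algebra.
From mathcomp Require Import boolp.

Set Implicit Arguments.
Unset Strict Implicit.
Unset Printing Implicit Defensive.

Import Order.TTheory GRing.Theory.
Local Open Scope ring_scope.

(** Both functors are left Kan extensions: [Ind Q k] along the inclusion of [Q]
    and [Cont intQ k] along the floor map. For every order-preserving [f], the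
    extension [lan k f] is left adjoint to the restriction [pull] along [f]
    ([lan_adjunction]). Since [floor x] is the largest element of [Q] below [x],
    [Ind Q k] is itself isomorphic to the restriction along the floor map
    ([floor_ind], [ind_floor]). This gives the adjunction between [Cont intQ k]
    and [Ind Q k] and the exactness of [Ind Q k]. An explicit inverse of the
    counit shows that [Cont intQ k] after [Ind Q k] is the identity.

    Right exactness of [lan k f] is proved on the generators and relations that
    define colimits ([colim_kernel]). Finite presentability is preserved by
    [lan k f] because it preserves cokernels, being a left adjoint, and direct
    sums, being additive, and because it sends the principal upset at [a] to the
    one at [f a] ([lan_upset]). The adjunction then restricts to finitely presentable modules
    with the same transposition.

    [Cont intQ k] preserves projectives because its right adjoint [Ind Q k]
    preserves epimorphisms, being a left adjoint as well. As for indecomposable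
    projectives, each is isomorphic to a principal upset
    ([projective_indecomposable_upset]), so that its contraction is the principal
    upset at the floor, which is indecomposable. To see this, let [M] be
    projective, and split the cover of [M] by the free module on its elements.
    If no principal upset is a retract of [M], then no coordinate of the section
    takes a nonzero value in its own degree. Expand the image of some [v] under
    the section as a finite combination of basis elements, and choose among the
    nonzero coordinates one of maximal degree. Covering and applying the section
    again reproduces the same expansion, but no term of it can contribute to the
    chosen coordinate: a contribution to a coordinate comes only from strictly
    larger degrees. Hence [v = 0]. So a nonzero projective module has a principal
    upset as a retract, and is isomorphic to it when it is indecomposable. *)

(** * Isomorphisms and adjunctions *)

Section Isomorphisms.
Variable C : category.
Implicit Types a b c : C.

Lemma isomorphic_sym a b : isomorphic a b -> isomorphic b a.
Proof. by case=> f [g [gf fg]]; exists g, f. Qed.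

Lemma isomorphic_trans a b c :
  isomorphic a b -> isomorphic b c -> isomorphic a c.
Proof.
case=> f [f' [f'f ff']] [g [g' [g'g gg']]].
exists (mcomp g f), (mcomp f' g'); split.
  by rewrite -mcompA (mcompA g') g'g mcomp_idl.
by rewrite -mcompA (mcompA f) ff' mcomp_idl.
Qed.

End Isomorphisms.

Lemma functor_isomorphic (C D : category) (F : functor C D) (a b : C) :
  isomorphic a b -> isomorphic (F a) (F b).
Proof.
case=> f [g [gf fg]]; exists (fmap F f), (fmap F g).
by rewrite -!fmap_comp gf fg !fmap_id.
Qed.

Section Adjunctions.
Variables (C D : category) (F : functor C D) (G : functor D C).
Variable adj : adjunction F G.

Lemma transpose_inj c x : injective (transpose adj (c := c) (x := x)).
Proof. exact: bij_inj (transpose_bij adj c x). Qed.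

Lemma transpose_surj c x (h : mor c (G x)) : exists g, transpose adj g = h.
Proof. by have [u _ uK] := transpose_bij adj c x; exists (u h). Qed.

Lemma left_adjoint_epi a b (e : mor a b) : is_epi e -> is_epi (fmap F e).
Proof.
move=> epi_e c g h gh; apply: transpose_inj; apply: epi_e.
by rewrite -!transpose_natl gh.
Qed.

Lemma left_adjoint_projective p :
  (forall a b (e : @mor D a b), is_epi e -> is_epi (fmap G e)) ->
  projective p -> projective (F p).
Proof.
move=> G_epi proj_p a b e f epi_e.
have [h eh] := proj_p _ _ _ (transpose adj f) (G_epi _ _ _ epi_e).
have [g gh] := transpose_surj h.
by exists g; apply: transpose_inj; rewrite transpose_natr gh.
Qed.

End Adjunctions.

(** A right adjoint may be replaced by a naturally isomorphic functor. *)
Section IsomorphicRightAdjoint.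
Variables (C D : category) (F : functor C D) (G G' : functor D C).
Variables (adj : adjunction F G) (theta : forall x, mor (G x) (G' x)).
Variable theta' : forall x, mor (G' x) (G x).
Hypothesis thetaK : forall x, mcomp (theta' x) (theta x) = idm (G x).
Hypothesis theta'K : forall x, mcomp (theta x) (theta' x) = idm (G' x).
Hypothesis theta_nat : forall x y (h : mor x y),
  mcomp (theta y) (fmap G h) = mcomp (fmap G' h) (theta x).

Let tr c x (g : mor (F c) x) : mor c (G' x) :=
  mcomp (theta x) (transpose adj g).

Lemma iso_transpose_bij c x : bijective (@tr c x).
Proof.
have [u trK uK] := transpose_bij adj c x.
exists (fun h => u (mcomp (theta' x) h)) => [g|h]; rewrite /tr.
  by rewrite mcompA thetaK mcomp_idl trK.
by rewrite uK mcompA theta'K mcomp_idl.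
Qed.

Lemma iso_transpose_natl c c' x (g : mor (F c) x) (f : mor c' c) :
  tr (mcomp g (fmap F f)) = mcomp (tr g) f.
Proof. by rewrite /tr transpose_natl mcompA. Qed.

Lemma iso_transpose_natr c x x' (h : mor x x') (g : mor (F c) x) :
  tr (mcomp h g) = mcomp (fmap G' h) (tr g).
Proof. by rewrite /tr transpose_natr !mcompA theta_nat. Qed.

Definition iso_adjunction : adjunction F G' :=
  Adjunction iso_transpose_bij iso_transpose_natl iso_transpose_natr.

End IsomorphicRightAdjoint.

(** An adjunction restricts to full subcategories preserved by both functors. *)
Section RestrictAdjunction.
Variables (C D : category) (X : C -> Prop) (Y : D -> Prop).
Variables (F : functor C D) (G : functor D C).
Hypotheses (FXY : forall a, X a -> Y (F a)) (GYX : forall b, Y b -> X (G b)).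
Variable adj : adjunction F G.

Let CX := full_subcategory X.
Let DY := full_subcategory Y.
Let FX : functor CX DY := restrict_functor FXY.
Let GY : functor DY CX := restrict_functor GYX.

Definition restrict_adjunction : adjunction FX GY :=
  @Adjunction CX DY FX GY
    (fun c x => transpose adj (c := sval c) (x := sval x))
    (fun c x => transpose_bij adj (sval c) (sval x))
    (fun c c' x g f => transpose_natl adj g f)
    (fun c x x' h g => transpose_natr adj h g).

End RestrictAdjunction.

(** * Morphisms of persistence modules *)

Section Morphisms.
Variables (k : fieldType) (d : Order.disp_t) (S : porderType d).
Implicit Types M N L : Rep k S.

(** Rewriting with this equation instead of simplifying keeps the Kan extensions
    and their descent maps folded. *)
Lemma pmod_mcompE M N L (g : mor N L) (f : mor M N) x v :
  (mcomp g f : mor M L) x v = g x (f x v).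
Proof. by []. Qed.

Lemma is_iso_pointwise M N (f : mor M N) (g : forall x, {linear N x -> M x}) :
  (forall x, cancel (f x) (g x)) -> (forall x, cancel (g x) (f x)) -> is_iso f.
Proof.
move=> fK gK.
have g_nat x y (le_xy : (x <= y)%O) v :
    g y (pmod_map N le_xy v) = pmod_map M le_xy (g x v).
  by rewrite -{1}[v]gK -hom_nat fK.
exists (PmodHom g_nat); split; apply: pmod_hom_ext => x v /=; first exact: fK.
exact: gK.
Qed.

Lemma iso_pointwise M N (f : mor M N) : is_iso f ->
  exists g : mor N M,
    (forall x, cancel (f x) (g x)) /\ (forall x, cancel (g x) (f x)).
Proof.
case=> g [gf fg]; exists g; split=> x v.
  by have /(congr1 (fun h : mor M M => h x v)) := gf.
by have /(congr1 (fun h : mor N N => h x v)) := fg.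
Qed.

Lemma pointwise_surj_epi M N (f : mor M N) : pointwise_surj f -> is_epi f.
Proof.
move=> f_surj L g h gh; apply: pmod_hom_ext => x w.
have [v <-] := f_surj x w.
by have /(congr1 (fun h : mor M L => h x v)) := gh.
Qed.

Lemma is_zero_isomorphic M N : isomorphic M N -> is_zero M -> is_zero N.
Proof.
case=> f /iso_pointwise [g [_ gK]] M0 x w.
by rewrite -[w]gK (M0 x (g x w)) linear0.
Qed.

Lemma zero_isomorphic M N : is_zero M -> is_zero N -> isomorphic M N.
Proof.
move=> M0 N0; exists (zero_hom M N).
by apply: (@is_iso_pointwise _ _ _ (zero_hom N M)) => x v /=;
  rewrite ?(M0 _ v) ?(N0 _ v).
Qed.

Lemma indecomposable_isomorphic M N :
  isomorphic M N -> indecomposable M -> indecomposable N.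
Proof.
move=> MN [M0 Mdec]; split.
  by move=> N0; apply: M0; apply: is_zero_isomorphic (isomorphic_sym MN) N0.
by move=> A B NAB; apply: Mdec; apply: isomorphic_trans MN NAB.
Qed.

Lemma zero_hom_compl M N L (f : mor M N) :
  mcomp (zero_hom N L) f = zero_hom M L.
Proof. exact: pmod_hom_ext. Qed.

(** Cokernels are transported along isomorphisms of the two modules of a
    presentation. *)
Lemma is_cokernel_isomorphic M N M' N' L (f : mor M N) (g : mor N L) :
  isomorphic M M' -> isomorphic N N' -> is_cokernel f g ->
  exists (f' : mor M' N') (g' : mor N' L), is_cokernel f' g'.
Proof.
case=> m [m' [m'm mm']] [n [n' [n'n nn']]] [gf0 g_univ].
exists (mcomp n (mcomp f m')), (mcomp g n'); split.
  by rewrite -mcompA (mcompA n') n'n mcomp_idl mcompA gf0 zero_hom_compl.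
move=> K h h0.
have [|u [ug u_uniq]] := g_univ K (mcomp h n).
  have /(congr1 (mcomp^~ m)) := h0.
  by rewrite zero_hom_compl -!mcompA m'm mcomp_idr.
exists u; split; first by rewrite mcompA ug -mcompA nn' mcomp_idr.
move=> u' u'g; apply: u_uniq.
by rewrite -u'g -!mcompA n'n mcomp_idr.
Qed.

End Morphisms.

(** * Direct sums *)

Section DirectSums.
Variables (k : fieldType) (d : Order.disp_t) (S : porderType d).
Implicit Types M N L : Rep k S.

Definition dsum_fst M N : mor (dsum M N) M :=
  @PmodHom k d S (dsum M N) M (fun x => fst : {linear (M x * N x)%type -> M x})
    (fun _ _ _ _ => erefl).

Definition dsum_snd M N : mor (dsum M N) N :=
  @PmodHom k d S (dsum M N) N (fun x => snd : {linear (M x * N x)%type -> N x})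
    (fun _ _ _ _ => erefl).

Section Pairing.
Variables (M N L : Rep k S) (g : mor L M) (h : mor L N).

Definition dsum_pair_at x (v : L x) : (M x * N x)%type := (g x v, h x v).

Lemma dsum_pair_linear x : linear (@dsum_pair_at x).
Proof. by move=> c v w; rewrite /dsum_pair_at !linearP. Qed.

HB.instance Definition _ x :=
  GRing.isLinear.Build k (L x) (M x * N x)%type _ (@dsum_pair_at x)
    (@dsum_pair_linear x).

Lemma dsum_pair_nat x y (le_xy : (x <= y)%O) (v : L x) :
  dsum_pair_at (pmod_map L le_xy v) = pmod_map (dsum M N) le_xy (dsum_pair_at v).
Proof. by rewrite /dsum_pair_at !hom_nat. Qed.

(** The morphism into a direct sum with components [g] and [h] *)
Definition dsum_pair : mor L (dsum M N) :=
  @PmodHom k d S L (dsum M N) (fun x => @dsum_pair_at x) dsum_pair_nat.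

End Pairing.

Definition dsum_inl M N : mor M (dsum M N) := dsum_pair (idm M) (zero_hom M N).
Definition dsum_inr M N : mor N (dsum M N) := dsum_pair (zero_hom N M) (idm N).

Lemma dsum_isomorphic M N M' N' :
  isomorphic M M' -> isomorphic N N' -> isomorphic (dsum M N) (dsum M' N').
Proof.
case=> m [m' [m'm mm']] [n [n' [n'n nn']]].
exists (dsum_pair (mcomp m (dsum_fst M N)) (mcomp n (dsum_snd M N))).
exists (dsum_pair (mcomp m' (dsum_fst M' N')) (mcomp n' (dsum_snd M' N'))).
split; apply: pmod_hom_ext => x [v w]; congr pair.
- by have /(congr1 (fun h : mor M M => h x v)) := m'm.
- by have /(congr1 (fun h : mor N N => h x w)) := n'n.
- by have /(congr1 (fun h : mor M' M' => h x v)) := mm'.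
- by have /(congr1 (fun h : mor N' N' => h x w)) := nn'.
Qed.

End DirectSums.

Lemma additive_dsum (k : fieldType) d d' (S : porderType d) (T : porderType d')
    (F : functor (Rep k S) (Rep k T)) (M N : Rep k S) :
  additive_functor F -> isomorphic (F (dsum M N)) (dsum (F M) (F N)).
Proof.
move=> FD.
have F0 A B x v : fmap F (zero_hom A B) x v = 0.
  have /(congr1 (fun h : mor (F A) (F B) => h x v)) :=
    FD A B (zero_hom A B) (zero_hom A B).
  have -> : pmod_addm (zero_hom A B) (zero_hom A B) = zero_hom A B.
    by apply: pmod_hom_ext => y w; rewrite /= addr0.
  by move/eqP; rewrite eq_sym -subr_eq0 /= addrK => /eqP.
pose i := dsum_inl M N; pose j := dsum_inr M N.
pose p := dsum_fst M N; pose q := dsum_snd M N.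
exists (dsum_pair (fmap F p) (fmap F q)).
exists (pmod_addm (mcomp (fmap F i) (dsum_fst _ _))
  (mcomp (fmap F j) (dsum_snd _ _))).
split.
  have -> : idm (F (dsum M N)) = fmap F (pmod_addm (mcomp i p) (mcomp j q)).
    rewrite -fmap_id; congr fmap; apply: pmod_hom_ext => x [v w].
    by congr pair; rewrite /= ?addr0 ?add0r.
  by rewrite FD !fmap_comp; apply: pmod_hom_ext.
have FE A B C (g : mor B C) (h : mor A B) x v :
    fmap F g x (fmap F h x v) = fmap F (mcomp g h) x v by rewrite fmap_comp.
have pi : mcomp p i = idm M by apply: pmod_hom_ext.
have pj : mcomp p j = zero_hom N M by apply: pmod_hom_ext.
have qi : mcomp q i = zero_hom M N by apply: pmod_hom_ext.
have qj : mcomp q j = idm N by apply: pmod_hom_ext.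
apply: pmod_hom_ext => x [v w]; congr pair; rewrite /= linearD !FE.
  by rewrite pi pj F0 fmap_id addr0.
by rewrite qi qj F0 fmap_id add0r.
Qed.

(** * Left Kan extension along an order-preserving map *)

Section KanExtension.
Variables (k : fieldType) (d d' : Order.disp_t).
Variables (S : porderType d) (T : porderType d') (f : S -> T).
Hypothesis f_homo : {homo f : x y / (x <= y)%O}.

Section PullObject.
Variable N : Rep k T.

Lemma pull_map_id x (le_xx : (x <= x)%O) v :
  pmod_map N (f_homo le_xx) v = v.
Proof. exact: pmod_id. Qed.

Lemma pull_map_comp x y z (le_xy : (x <= y)%O) (le_yz : (y <= z)%O)
    (le_xz : (x <= z)%O) v :
  pmod_map N (f_homo le_yz) (pmod_map N (f_homo le_xy) v) =
  pmod_map N (f_homo le_xz) v.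
Proof. exact: pmod_comp. Qed.

Definition pull_ob : Rep k S :=
  @Pmod k d S (fun x => N (f x)) (fun x y le_xy => pmod_map N (f_homo le_xy))
    pull_map_id pull_map_comp.

End PullObject.

Definition pull_hom (M N : Rep k T) (h : mor M N) :
    mor (pull_ob M) (pull_ob N) :=
  @PmodHom k d S (pull_ob M) (pull_ob N) (fun x => h (f x))
    (fun x y le_xy v => hom_nat h (f_homo le_xy) v).

Lemma pull_hom_id M : pull_hom (idm M) = idm (pull_ob M).
Proof. exact: pmod_hom_ext. Qed.

Lemma pull_hom_comp M N L (h : mor N L) (g : mor M N) :
  pull_hom (mcomp h g) = mcomp (pull_hom h) (pull_hom g).
Proof. exact: pmod_hom_ext. Qed.

(** Restriction along [f] *)
Definition pull : functor (Rep k T) (Rep k S) :=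
  Functor pull_hom_id pull_hom_comp.

Lemma down_fiber_self a : a \in down_fiber f (f a).
Proof. by rewrite inE. Qed.

(** The unit of the adjunction between [lan] and [pull] *)
Definition lan_unit (M : Rep k S) a : {linear M a -> lan_at f M (f a)} :=
  lan_in M (down_fiber_self a).

(** Every coprojection is the unit followed by a structure map, so that a morphism
    out of [lan_ob f M] is determined by its composite with the unit
    ([lan_hom_eq]). *)
Lemma lan_unit_map M a y (fa : a \in down_fiber f y) v :
  pmod_map (lan_ob f M) (fa : (f a <= y)%O) (lan_unit M a v) = lan_in M fa v.
Proof. exact: lan_map_in. Qed.

Section Transpose.
Variables (M : Rep k S) (N : Rep k T).

Lemma lan_transpose_nat (g : mor (lan_ob f M) N) a b (le_ab : (a <= b)%O) v :
  g (f b) (lan_unit M b (pmod_map M le_ab v)) =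
  pmod_map N (f_homo le_ab) (g (f a) (lan_unit M a v)).
Proof.
rewrite -hom_nat; congr (g (f b) _).
have fa : a \in down_fiber f (f b) by apply: f_homo.
rewrite [LHS](lan_in_map fa) -[LHS]lan_unit_map.
by congr (pmod_map _ _ _); apply: bool_irrelevance.
Qed.

(** The transpose of [g], with inverse [lan_desc] *)
Definition lan_transpose (g : mor (lan_ob f M) N) : mor M (pull_ob N) :=
  @PmodHom k d S M (pull_ob N) (fun a => g (f a) \o lan_unit M a)
    (lan_transpose_nat g).

Lemma lan_hom_eq (g h : mor (lan_ob f M) N) :
  (forall a v, g (f a) (lan_unit M a v) = h (f a) (lan_unit M a v)) -> g = h.
Proof.
move=> gh; apply: pmod_hom_ext => y; apply: lan_ext => a fa v.
by rewrite -lan_unit_map !hom_nat gh.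
Qed.

Section Descent.
Variable h : mor M (pull_ob N).

Definition lan_desc_cocone y (a : subposet (down_fiber f y)) :
    {linear M (val a) -> N y} :=
  pmod_map N (valP a : (f (val a) <= y)%O) \o h (val a).

Lemma lan_desc_coconeP y (a b : subposet (down_fiber f y))
    (le_ab : (a <= b)%O) v :
  lan_desc_cocone b (pmod_map (restrict M (down_fiber f y)) le_ab v) =
  lan_desc_cocone a v.
Proof.
rewrite /lan_desc_cocone /= hom_nat.
by rewrite [LHS](pmod_comp _ _ (valP a : (f (val a) <= y)%O)).
Qed.

Definition lan_desc_at y : {linear lan_at f M y -> N y} :=
  colim_desc (@lan_desc_coconeP y).

Lemma lan_desc_in y a (fa : a \in down_fiber f y) v :
  lan_desc_at y (lan_in M fa v) = pmod_map N (fa : (f a <= y)%O) (h a v).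
Proof.
rewrite /lan_desc_at [LHS]colim_desc_in /=.
by congr (pmod_map _ _ _); apply: bool_irrelevance.
Qed.

Lemma lan_desc_nat x y (le_xy : (x <= y)%O) v :
  lan_desc_at y (pmod_map (lan_ob f M) le_xy v) =
  pmod_map N le_xy (lan_desc_at x v).
Proof.
apply: (lan_ext (g := lan_desc_at y \o lan_map f M le_xy)
  (h := pmod_map N le_xy \o lan_desc_at x)) => a fx w /=.
have fy := down_fiberS le_xy fx.
by rewrite (lan_map_in _ _ fy) !lan_desc_in (pmod_comp _ _ (fy : (f a <= y)%O)).
Qed.

(** The morphism out of the Kan extension induced by [h] *)
Definition lan_desc : mor (lan_ob f M) N :=
  @PmodHom k d' T (lan_ob f M) N lan_desc_at lan_desc_nat.

Lemma lan_desc_unit a v : lan_desc (f a) (lan_unit M a v) = h a v.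
Proof. by rewrite [LHS]lan_desc_in pmod_id. Qed.

End Descent.

Lemma lan_transposeK : cancel lan_transpose lan_desc.
Proof. by move=> g; apply: lan_hom_eq => a v; rewrite lan_desc_unit. Qed.

Lemma lan_descK : cancel lan_desc lan_transpose.
Proof. by move=> h; apply: pmod_hom_ext => a v; apply: lan_desc_unit. Qed.

End Transpose.

Lemma lan_hom_unit (M N : Rep k S) (h : mor M N) a v :
  lan_hom f h (f a) (lan_unit M a v) = lan_unit N a (h a v).
Proof. exact: lan_hom_at_in. Qed.

Lemma lan_transpose_natl (M M' : Rep k S) (N : Rep k T)
    (g : mor (lan_ob f M) N) (h : mor M' M) :
  lan_transpose (mcomp g (lan_hom f h)) = mcomp (lan_transpose g) h.
Proof.
by apply: pmod_hom_ext => a v /=; rewrite [lan_hom_at _ _ _ _]lan_hom_unit.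
Qed.

Lemma lan_transpose_natr (M : Rep k S) (N N' : Rep k T) (h : mor N N')
    (g : mor (lan_ob f M) N) :
  lan_transpose (mcomp h g) = mcomp (pull_hom h) (lan_transpose g).
Proof. exact: pmod_hom_ext. Qed.

Definition lan_adjunction : adjunction (lan k f) pull :=
  @Adjunction _ _ (lan k f) pull (fun M N => @lan_transpose M N)
    (fun M N => Bijective (@lan_transposeK M N) (@lan_descK M N))
    (fun M M' N => @lan_transpose_natl M M' N)
    (fun M N N' => @lan_transpose_natr M N N').

Lemma lan_additive : additive_functor (lan k f).
Proof.
move=> M N g h; apply: lan_hom_eq => a v /=.
by rewrite ![lan_hom_at _ _ _ _]lan_hom_unit /= linearD.
Qed.

Lemma pull_exact : exact_functor pull.
Proof.
split=> [M N g h|M N L g h [g_inj gh h_surj]]; first exact: pmod_hom_ext.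
split=> x; [exact: g_inj | exact: gh | exact: h_surj].
Qed.

End KanExtension.

(** * Right exactness *)

(** A colimit of surjections has no more relations than expected: an element
    killed by the induced map of colimits lies in every subgroup containing the
    images of the pointwise kernels. The map [rho] lifts the elements of the
    spaces [L a] along [g], without any linearity, and the defining relations of
    the colimit are followed one by one. *)
Lemma colim_kernel (k : fieldType) d (S : porderType d) (N L : Rep k S)
    (g : mor N L) (G : {linear colim N -> colim L}) (I : colim N -> Prop) :
  pointwise_surj g ->
  (forall a (v : N a), G (colim_in v) = colim_in (g a v)) ->
  I 0 -> (forall p q, I p -> I q -> I (p - q)) ->
  (forall a (v : N a), g a v = 0 -> I (colim_in v)) ->
  forall q, G q = 0 -> I q.
Proof.
move=> g_surj GE I0 IB Iker.
have IN p : I p -> I (- p) by rewrite -sub0r; apply: IB.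
have ID p q : I p -> I q -> I (p + q).
  by move=> Ip /IN; rewrite -{2}[q]opprK; apply: IB.
pose rho a (w : L a) : N a := sval (cid (g_surj a w)).
have rhoK a w : g a (rho a w) = w by rewrite /rho; case: cid.
pose ev (s : formal_sum L) : colim N :=
  \sum_(u <- s) colim_in (rho (tag u) (tagged u)).
have ev_cat s t : ev (s ++ t) = ev s + ev t by rewrite /ev big_cat.
have ev1 a (w : L a) : ev [:: elt w] = colim_in (rho a w) by rewrite /ev big_seq1.
have ev0 : ev [::] = 0 by rewrite /ev big_nil.
have evP s t : colim_eq s t -> I (ev s - ev t).
  elim=> {s t} [s|s t _ IH|s t u _ IH _ IH'|s s' t t' _ IH _ IH'|s t|a|a v w
    |a b le_ab v].
  - by rewrite subrr.
  - by rewrite -opprB; apply: IN.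
  - by rewrite -(subrKA (ev t)); apply: ID.
  - by rewrite !ev_cat opprD addrACA; apply: ID.
  - by rewrite !ev_cat [ev t + _]addrC subrr.
  - by rewrite ev0 subr0 ev1; apply: Iker; rewrite rhoK.
  - rewrite (ev_cat [:: _] [:: _]) !ev1 -linearD -linearB; apply: Iker.
    by rewrite linearB [X in _ - X]linearD !rhoK subrr.
  - rewrite !ev1 -(colim_in_map le_ab (rho a v)) -linearB; apply: Iker.
    by rewrite linearB /= hom_nat !rhoK subrr.
elim/colim_ind=> s Gs0.
pose t : formal_sum L := [seq elt (g (tag u) (tagged u)) | u <- s].
have Gs : G (class_of_sum s) = class_of_sum t.
  rewrite !class_of_sumE linear_sum big_map.
  by apply: eq_bigr => u _; rewrite GE.
have /evP : colim_eq t [::] by apply/class_eq; rewrite -Gs Gs0.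
rewrite ev0 subr0 => It; rewrite -[class_of_sum s](subrK (ev t)).
apply: (ID _ _ _ It); rewrite class_of_sumE /ev big_map -sumrB.
apply: (big_ind I) => // u _; rewrite -linearB; apply: Iker.
by rewrite linearB /= rhoK subrr.
Qed.

Section LanExactness.
Variables (k : fieldType) (d d' : Order.disp_t).
Variables (S : porderType d) (T : porderType d') (f : S -> T).

Lemma restrict_hom_nat (M N : Rep k S) (h : mor M N) (A : {pred S})
    (x y : subposet A) (le_xy : (x <= y)%O) v :
  h (val y) (pmod_map (restrict M A) le_xy v) =
  pmod_map (restrict N A) le_xy (h (val x) v).
Proof. exact: hom_nat. Qed.

(** The action of restriction to a subset on morphisms *)
Definition restrict_hom (M N : Rep k S) (h : mor M N) (A : {pred S}) :
    mor (restrict M A) (restrict N A) :=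
  @PmodHom k d _ (restrict M A) (restrict N A) (fun x => h (val x))
    (@restrict_hom_nat M N h A).

Lemma lan_surj (M N : Rep k S) (g : mor M N) :
  pointwise_surj g -> pointwise_surj (lan_hom f g).
Proof.
move=> g_surj x; elim/colim_ind=> s; rewrite class_of_sumE.
apply: (big_ind (fun w => exists v, lan_hom f g x v = w)).
- by exists 0; rewrite linear0.
- by move=> _ _ [v <-] [w <-]; exists (v + w); rewrite linearD.
move=> [[a fa] w] _ /=; have [v <-] := g_surj a w.
by exists (lan_in M fa v); apply: lan_hom_at_in.
Qed.

Lemma lan_right_exact : right_exact (lan k f).
Proof.
split=> [|M N L h g [_ hg g_surj]]; first exact: lan_additive.
split; last exact: lan_surj.
have gh0 a v : g a (h a v) = 0 by apply/hg; exists v.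
move=> x q; split=> [gq0|[u <-]]; last first.
  apply: (lan_ext (g := lan_hom f g x \o lan_hom f h x) (h := \0)) => a fa v /=.
  by rewrite !lan_hom_at_in gh0 linear0.
apply: (colim_kernel (g := restrict_hom g (down_fiber f x))
  (G := lan_hom f g x) (I := fun q => exists u, lan_hom f h x u = q)) gq0.
- by move=> a w; apply: g_surj.
- by move=> [a fa] v; apply: lan_hom_at_in.
- by exists 0; rewrite linear0.
- by move=> _ _ [v <-] [w <-]; exists (v - w); rewrite linearB.
move=> [a fa] v /hg [u <-]; exists (lan_in M fa u); exact: lan_hom_at_in.
Qed.

End LanExactness.

(** * Principal upsets *)

Section Upsets.
Variables (k : fieldType) (d : Order.disp_t) (S : porderType d).
Implicit Types (a x y : S) (M N : Rep k S).

(** The generator [1] of [upset_pmod k a] at [a] *)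
Definition upset_gen a : upset_pmod k a a :=
  line_if_map k true (a <= a)%O (1 : k^o).

Lemma line_ifE (b : bool) (w : line_if k b) :
  w = line_if_map k true b (line_if_map k b true w).
Proof. by case: b w => //= w; rewrite [w]thinmx0 [RHS]thinmx0. Qed.

Lemma upset_gen_map a x (le_ax : (a <= x)%O) :
  pmod_map (upset_pmod k a) le_ax (upset_gen a) =
  line_if_map k true (a <= x)%O (1 : k^o).
Proof.
by apply: line_if_map_comp; rewrite ?lexx ?le_ax.
Qed.

(** The generator spans the line over each point of the upset. *)
Lemma upset_eltE a x (le_ax : (a <= x)%O) (w : upset_pmod k a x) :
  w = line_if_map k (a <= x)%O true w *:
        pmod_map (upset_pmod k a) le_ax (upset_gen a).
Proof.
rewrite upset_gen_map -linearZ [LHS]line_ifE; congr (line_if_map _ _ _ _).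
by rewrite /GRing.scale /= mulr1.
Qed.

Lemma upset_elt0 a x (w : upset_pmod k a x) : ~~ (a <= x)%O -> w = 0.
Proof.
rewrite /= in w * => /negbTE nle; move: w; rewrite nle => w.
by rewrite [w]thinmx0 [RHS]thinmx0.
Qed.

Lemma upset_gen_coef a : line_if_map k (a <= a)%O true (upset_gen a) = (1 : k^o).
Proof. by rewrite line_if_map_comp ?implybT ?lexx. Qed.

Lemma upset_gen_neq0 a : upset_gen a <> 0.
Proof.
move/(congr1 (line_if_map k (a <= a)%O true)); rewrite upset_gen_coef linear0.
by move/eqP; rewrite oner_eq0.
Qed.

Lemma upset_hom_ext a M (g h : mor (upset_pmod k a) M) :
  g a (upset_gen a) = h a (upset_gen a) -> g = h.
Proof.
move=> gh; apply: pmod_hom_ext => x w.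
have [le_ax|nle] := boolP (a <= x)%O; last first.
  by rewrite (upset_elt0 w nle) !linear0.
by rewrite (upset_eltE le_ax w) !linearZ /= !hom_nat gh.
Qed.

Section Yoneda.
Variables (a : S) (M : Rep k S) (v : M a).

(** The scalar multiple of the image of [v] by the coordinate of [w]; it is [0]
    outside the upset of [a]. *)
Definition upset_hom_at x (w : upset_pmod k a x) : M x :=
  if pselect (a <= x)%O is left le_ax
  then (line_if_map k (a <= x)%O true w : k) *: pmod_map M le_ax v else 0.

Lemma upset_hom_atE x (le_ax : (a <= x)%O) (w : upset_pmod k a x) :
  upset_hom_at w =
  (line_if_map k (a <= x)%O true w : k) *: pmod_map M le_ax v.
Proof.
rewrite /upset_hom_at; case: pselect => [le|//].
by congr (_ *: pmod_map _ _ _); apply: bool_irrelevance.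
Qed.

Lemma upset_hom_linear x : linear (@upset_hom_at x).
Proof.
move=> c w w'; have [le_ax|nle] := boolP (a <= x)%O.
  by rewrite !(upset_hom_atE le_ax) linearP scalerDl scalerA.
rewrite /upset_hom_at; case: pselect => [le|_]; last by rewrite scaler0 addr0.
by rewrite le in nle.
Qed.

HB.instance Definition _ x :=
  GRing.isLinear.Build k (upset_pmod k a x) (M x) _ (@upset_hom_at x)
    (@upset_hom_linear x).

Lemma upset_hom_nat x y (le_xy : (x <= y)%O) (w : upset_pmod k a x) :
  upset_hom_at (pmod_map (upset_pmod k a) le_xy w) =
  pmod_map M le_xy (upset_hom_at w).
Proof.
have [le_ax|nle] := boolP (a <= x)%O; last first.
  by rewrite (upset_elt0 w nle) !linear0.
rewrite (upset_hom_atE le_ax) (upset_hom_atE (le_trans le_ax le_xy)) linearZ /=.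
rewrite (pmod_comp _ _ (le_trans le_ax le_xy)); congr (_ *: _).
by rewrite line_if_map_comp ?implybT ?upset_imply.
Qed.

(** The morphism sending the generator to a given element (Yoneda) *)
Definition upset_hom : mor (upset_pmod k a) M :=
  @PmodHom k d S (upset_pmod k a) M (fun x => @upset_hom_at x) upset_hom_nat.

Lemma upset_hom_gen : upset_hom a (upset_gen a) = v.
Proof.
rewrite /= (upset_hom_atE (lexx a)) pmod_id.
by rewrite upset_gen_coef scale1r.
Qed.

End Yoneda.

(** In a direct sum decomposition one of the summands vanishes at [a], since the
    value at [a] is a line. That summand is zero, since the module is generated by
    this line. *)
Lemma upset_indecomposable a : indecomposable (upset_pmod k a).
Proof.
split=> [/(_ _ (upset_gen a)) /upset_gen_neq0//|].
move=> A B [h /iso_pointwise [g [hK gK]]].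
set p : A a * B a := h a (upset_gen a).
have zeroA : p.1 = 0 -> is_zero A.
  move=> p0 x u; have := gK x (u, 0); set w := g x (u, 0).
  have [le_ax|nle] := boolP (a <= x)%O; last first.
    by rewrite (upset_elt0 w nle) linear0 => -[].
  rewrite (upset_eltE le_ax w) linearZ hom_nat -/p => /(congr1 fst) /= <-.
  by rewrite p0 linear0 scaler0.
have zeroB : p.2 = 0 -> is_zero B.
  move=> p0 x u; have := gK x (0, u); set w := g x (0, u).
  have [le_ax|nle] := boolP (a <= x)%O; last first.
    by rewrite (upset_elt0 w nle) linear0 => -[].
  rewrite (upset_eltE le_ax w) linearZ hom_nat -/p => /(congr1 snd) /= <-.
  by rewrite p0 linear0 scaler0.
have := gK a (p.1, 0); rewrite (upset_eltE (lexx a) (g a _)) linearZ hom_nat -/p.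
set c := line_if_map _ _ _ _; rewrite pmod_id => -[c1 c2].
(* [c] is the coefficient of the preimage of [(p.1, 0)]: if it vanishes, so does
   [p.1], and otherwise so does [p.2] *)
have [c0|c0] := eqVneq (c : k) 0.
  by left; apply: zeroA; rewrite -c1 c0 scale0r.
by right; apply: zeroB; move/eqP: c2; rewrite scaler_eq0 (negbTE c0) => /eqP.
Qed.

End Upsets.

(** * Kan extensions of finitely presentable modules *)

Section LanPresentation.
Variables (k : fieldType) (d d' : Order.disp_t).
Variables (S : porderType d) (T : porderType d') (f : S -> T).
Hypothesis f_homo : {homo f : x y / (x <= y)%O}.

(** By adjunction and Yoneda, both modules represent evaluation at [f a]. *)
Lemma lan_upset a : isomorphic (lan k f (upset_pmod k a)) (upset_pmod k (f a)).
Proof.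
pose h : mor (upset_pmod k a) (pull_ob f_homo (upset_pmod k (f a))) :=
  upset_hom (M := pull_ob f_homo (upset_pmod k (f a))) (upset_gen k (f a)).
exists (lan_desc (f_homo := f_homo) h).
exists (upset_hom (M := lan_ob f _)
  (lan_unit f (upset_pmod k a) a (upset_gen k a))).
split; last first.
  apply: upset_hom_ext.
  by rewrite pmod_mcompE upset_hom_gen lan_desc_unit upset_hom_gen.
apply: (transpose_inj (adj := lan_adjunction k f_homo)); apply: upset_hom_ext.
by rewrite [LHS]pmod_mcompE lan_desc_unit !upset_hom_gen.
Qed.

Lemma lan_zero : isomorphic (lan k f (zero_pmod k S)) (zero_pmod k T).
Proof.
apply: zero_isomorphic => x v; last exact: thinmx0.
apply: (lan_ext (g := idfun) (h := \0)) => a fa w /=.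
by rewrite [w]thinmx0 linear0.
Qed.

Lemma lan_upset_sum I :
  isomorphic (lan k f (upset_sum k I)) (upset_sum k (map f I)).
Proof.
elim: I => [|a I IH]; first exact: lan_zero.
apply: isomorphic_trans (dsum_isomorphic (lan_upset a) IH).
exact/additive_dsum/lan_additive.
Qed.

Lemma lan_zero_hom (M N : Rep k S) :
  lan_hom f (zero_hom M N) = zero_hom (lan_ob f M) (lan_ob f N).
Proof. by apply: lan_hom_eq => a v; rewrite lan_hom_unit linear0. Qed.

Lemma lan_transpose_zero (M : Rep k S) (N : Rep k T) :
  lan_transpose f_homo (zero_hom (lan_ob f M) N) = zero_hom M (pull_ob f_homo N).
Proof. exact: pmod_hom_ext. Qed.

Lemma lan_cokernel (M N L : Rep k S) (g : mor M N) (h : mor N L) :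
  is_cokernel g h -> is_cokernel (lan_hom f g) (lan_hom f h).
Proof.
case=> hg0 h_univ; split; first by rewrite -lan_hom_comp hg0 lan_zero_hom.
move=> K u u0.
have [|w [wh w_uniq]] := h_univ (pull_ob f_homo K) (lan_transpose f_homo u).
  by rewrite -lan_transpose_natl u0 lan_transpose_zero.
exists (lan_desc w); split.
  apply: (can_inj (@lan_transposeK _ _ _ _ _ _ f_homo _ _)).
  by rewrite lan_transpose_natl lan_descK.
move=> w' w'h; rewrite -[w'](@lan_transposeK _ _ _ _ _ _ f_homo).
by congr lan_desc; apply: w_uniq; rewrite -lan_transpose_natl w'h.
Qed.

Lemma lan_finitely_presentable (M : Rep k S) :
  finitely_presentable M -> finitely_presentable (lan k f M).
Proof.
case=> I [J [g [h /lan_cokernel coker]]]; exists (map f I), (map f J).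
exact: is_cokernel_isomorphic (lan_upset_sum J) (lan_upset_sum I) coker.
Qed.

End LanPresentation.

(** * Retracts of indecomposable modules *)

Section Kernel.
Variables (k : fieldType) (d : Order.disp_t) (S : porderType d).
Variables (M N : Rep k S) (g : mor M N).

Definition ker_at x : {pred M x} := [pred v | g x v == 0].
Arguments ker_at x _ /.

Lemma ker_at_submod x : submod_closed (@ker_at x).
Proof.
split=> [|c v w]; rewrite !inE /=; first by rewrite linear0.
by move=> /eqP gv /eqP gw; rewrite linearP gv gw scaler0 addr0.
Qed.

HB.instance Definition _ x :=
  GRing.isSubmodClosed.Build k (M x) (@ker_at x) (@ker_at_submod x).

Definition ker_ob x : Type := {v : M x | v \in @ker_at x}.
HB.instance Definition _ x :=
  SubChoice.copy (ker_ob x) {v : M x | v \in @ker_at x}.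
HB.instance Definition _ x := [SubChoice_isSubLmodule of ker_ob x by <:].

Lemma ker_map_subproof x y (le_xy : (x <= y)%O) (v : ker_ob x) :
  pmod_map M le_xy (val v) \in @ker_at y.
Proof. by have /eqP gv := valP v; rewrite inE /= hom_nat gv linear0. Qed.

Definition ker_map x y (le_xy : (x <= y)%O) (v : ker_ob x) : ker_ob y :=
  exist (fun w => w \in @ker_at y) _ (ker_map_subproof le_xy v).

Lemma ker_map_linear x y (le_xy : (x <= y)%O) : linear (ker_map le_xy).
Proof. by move=> c v w; apply: val_inj; rewrite /= !linearP. Qed.

HB.instance Definition _ x y (le_xy : (x <= y)%O) :=
  GRing.isLinear.Build k (ker_ob x) (ker_ob y) _ (ker_map le_xy)
    (ker_map_linear le_xy).

Lemma ker_map_id x (le_xx : (x <= x)%O) v : ker_map le_xx v = v.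
Proof. by apply: val_inj; apply: pmod_id. Qed.

Lemma ker_map_comp x y z (le_xy : (x <= y)%O) (le_yz : (y <= z)%O)
    (le_xz : (x <= z)%O) v : ker_map le_yz (ker_map le_xy v) = ker_map le_xz v.
Proof. by apply: val_inj; apply: pmod_comp. Qed.

(** The kernel of [g], as the submodule of the elements sent to [0] *)
Definition ker_pmod : Rep k S :=
  @Pmod k d S (fun x => ker_ob x : lmodType k) (fun x y le_xy => ker_map le_xy)
    ker_map_id ker_map_comp.

(** When [g] is a split epimorphism with section [f], its kernel is a complement
    of the image of [f] in [M], the projection sending [v] to [v - f (g v)]. *)
Variable f : mor N M.
Hypothesis gf : mcomp g f = idm N.

Lemma retractK x : cancel (f x) (g x).
Proof. by move=> v; have /(congr1 (fun h : mor N N => h x v)) := gf. Qed.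

Lemma ker_proj_subproof x (v : M x) : v - f x (g x v) \in @ker_at x.
Proof. by rewrite inE /= linearB /= retractK subrr. Qed.

Definition ker_proj_at x (v : M x) : ker_ob x :=
  exist (fun w => w \in @ker_at x) _ (ker_proj_subproof v).

Lemma ker_proj_linear x : linear (@ker_proj_at x).
Proof.
move=> c v w; apply: val_inj; rewrite [LHS]/= (linearP (g x)) (linearP (f x)) /=.
by rewrite scalerBr opprD addrACA.
Qed.

HB.instance Definition _ x :=
  GRing.isLinear.Build k (M x) (ker_ob x) _ (@ker_proj_at x)
    (@ker_proj_linear x).

Lemma ker_proj_nat x y (le_xy : (x <= y)%O) (v : M x) :
  ker_proj_at (pmod_map M le_xy v) = pmod_map ker_pmod le_xy (ker_proj_at v).
Proof. by apply: val_inj; rewrite /= linearB /= !hom_nat. Qed.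

Definition ker_proj : mor M ker_pmod :=
  @PmodHom k d S M ker_pmod (fun x => @ker_proj_at x) ker_proj_nat.

Definition retract_join_at x (v : (N x * ker_ob x)%type) : M x :=
  f x v.1 + val v.2.

Lemma retract_join_linear x : linear (@retract_join_at x).
Proof.
move=> c v w; rewrite /retract_join_at /= !linearP.
by rewrite scalerDr addrACA.
Qed.

HB.instance Definition _ x :=
  GRing.isLinear.Build k (N x * ker_ob x)%type (M x) _ (@retract_join_at x)
    (@retract_join_linear x).

Lemma retract_dsum : isomorphic M (dsum N ker_pmod).
Proof.
exists (dsum_pair g ker_proj).
apply: (is_iso_pointwise (g := fun x =>
  (@retract_join_at x : {linear dsum N ker_pmod x -> M x}))) => x.
  by move=> v; rewrite /= /retract_join_at /= subrKC.
move=> [v w]; have /eqP gw := valP w.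
have gvw : g x (f x v + val w) = v by rewrite linearD /= retractK gw addr0.
by congr pair; [exact: gvw|apply: val_inj]; rewrite /= gvw addrC addKr.
Qed.

Lemma retract_indecomposable : indecomposable M -> ~ is_zero N -> isomorphic M N.
Proof.
case=> _ /(_ _ _ retract_dsum) [//|ker0 _]; exists g.
apply: (@is_iso_pointwise _ _ _ _ _ _ f) => x v; last exact: retractK.
have /(congr1 val) /= := ker0 x (ker_proj_at v).
by move/eqP; rewrite subr_eq0 eq_sym => /eqP.
Qed.

End Kernel.

(** * Free modules and indecomposable projectives *)

(** The discrete order on a type: an alias of [X], ordered by equality *)
Definition discrete (X : choiceType) : Type := X.

HB.instance Definition _ (X : choiceType) := Choice.on (discrete X).

Section Discrete.
Variable X : choiceType.
Implicit Types x y z : discrete X.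

Lemma discrete_anti : antisymmetric (fun x y => x == y).
Proof. by move=> x y /andP [/eqP]. Qed.

Lemma discrete_trans : transitive (fun x y => x == y).
Proof. by move=> y x z /eqP ->. Qed.

HB.instance Definition _ :=
  Order.Le_isPOrder.Build (Order.Disp tt tt) (discrete X)
    (fun x => eqxx x) discrete_anti discrete_trans.

End Discrete.

(** A free module is extended from the discrete order on its basis. *)
Section FreeModule.
Variables (k : fieldType) (d : Order.disp_t) (S : porderType d).
Variables (X : choiceType) (deg : X -> S).

Let pt : discrete X -> S := deg.

Lemma discrete_homo : {homo pt : s t / (s <= t)%O}.
Proof. by move=> s t /eqP ->. Qed.

(** The constant module on the discrete order *)
Definition const_pmod : Rep k (discrete X) :=
  @Pmod k _ (discrete X) (fun _ => k^o : lmodType k) (fun _ _ _ => idfun)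
    (fun _ _ _ => erefl) (fun _ _ _ _ _ _ _ => erefl).

(** The free module with a basis element of degree [deg s] for each [s],
    obtained as a Kan extension along [deg] from the discrete order *)
Definition free_pmod : Rep k S := lan_ob pt const_pmod.

(** The basis element of [s] *)
Definition free_gen (s : X) : free_pmod (deg s) :=
  lan_unit pt const_pmod s (1 : k^o).

Section FreeHom.
Variables (M : Rep k S) (w : forall s : X, M (deg s)).

Definition scale_on s (c : k^o) : M (pt s) := (c : k) *: w s.

Lemma scale_on_linear s : linear (@scale_on s).
Proof. by move=> c u v; rewrite /scale_on scalerDl scalerA. Qed.

HB.instance Definition _ s :=
  GRing.isLinear.Build k k^o (M (pt s)) _ (@scale_on s) (@scale_on_linear s).

Lemma scale_on_nat (s t : discrete X) (le_st : (s <= t)%O) (c : k^o) :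
  scale_on t c = pmod_map (pull_ob discrete_homo M) le_st (scale_on s c).
Proof. by have /eqP e := le_st; case: _ / e in le_st *; rewrite pmod_id. Qed.

(** The morphism sending the basis element of [s] to [w s] *)
Definition free_hom : mor free_pmod M :=
  lan_desc (f_homo := discrete_homo) (M := const_pmod)
    (@PmodHom k _ (discrete X) const_pmod (pull_ob discrete_homo M)
       (fun s => @scale_on s) scale_on_nat).

Lemma free_hom_gen s : free_hom (deg s) (free_gen s) = w s.
Proof. by rewrite [LHS]lan_desc_unit; apply: scale1r. Qed.

End FreeHom.

(** The inclusion of the summand generated by the basis element of [s] *)
Definition free_in (s : X) : mor (upset_pmod k (deg s)) free_pmod :=
  upset_hom (free_gen s).

(** The projection onto that summand, that is, the coordinate along [s] *)
Definition free_coord (s : X) : mor free_pmod (upset_pmod k (deg s)) :=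
  free_hom (M := upset_pmod k (deg s))
    (fun t => line_if_map k true (deg s <= deg t)%O ((t == s)%:R : k^o)).

Lemma free_coord_gen s t : s != t -> free_coord s (deg t) (free_gen t) = 0.
Proof. by rewrite eq_sym free_hom_gen => /negbTE ->; rewrite linear0. Qed.

Lemma free_inK s : mcomp (free_coord s) (free_in s) = idm (upset_pmod k (deg s)).
Proof.
by apply: upset_hom_ext; rewrite pmod_mcompE upset_hom_gen free_hom_gen eqxx.
Qed.

Lemma free_coord_in s t : s != t ->
  mcomp (free_coord s) (free_in t) = zero_hom _ _.
Proof.
move=> st; apply: upset_hom_ext.
by rewrite pmod_mcompE upset_hom_gen free_coord_gen.
Qed.

Lemma free_in_elt x (s : discrete X) (fs : s \in down_fiber pt x)
    (c : const_pmod s) :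
  exists z, lan_in const_pmod fs c = free_in s x z.
Proof.
exists (line_if_map k true (deg s <= x)%O (c : k^o)).
have -> : line_if_map k true (deg s <= x)%O (c : k^o) =
    (c : k) *: pmod_map (upset_pmod k (deg s)) (fs : (pt s <= x)%O)
      (upset_gen k (deg s)).
  by rewrite upset_gen_map -linearZ /= /GRing.scale /= mulr1.
rewrite linearZ hom_nat upset_hom_gen -lan_unit_map -!linearZ.
by rewrite (_ : (c : k)%:A = c :> k^o) //; apply: mulr1.
Qed.

(** Each element is the sum of finitely many of its coordinates. The induction
    proves the expansion over every duplicate-free list containing a given one,
    so that expansions of two elements can be added over a common list. *)
Lemma free_span x (y : free_pmod x) : exists F : seq X,
  y = \sum_(s <- F) free_in s x (free_coord s x y).
Proof.
suff [F FP] : exists F : seq X, forall G : seq X, uniq G -> {subset F <= G} ->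
    y = \sum_(s <- G) free_in s x (free_coord s x y).
  exists (undup F).
  by apply: FP; [exact: undup_uniq | move=> s; rewrite mem_undup].
elim/colim_ind: y => s0; rewrite class_of_sumE.
apply: (big_ind (fun y : free_pmod x => exists F : seq X, forall G : seq X,
  uniq G -> {subset F <= G} ->
  y = \sum_(s <- G) free_in s x (free_coord s x y))).
- by exists [::] => G _ _; rewrite big1 // => s _; rewrite !linear0.
- move=> y y' [F FP] [F' FP']; exists (F ++ F') => G uG FG.
  under eq_bigr do rewrite !linearD /=.
  rewrite big_split /= -FP -?FP' // => s sF; apply: FG;
    by rewrite mem_cat sF ?orbT.
move=> [[s fs] c] _; have [z zE] := free_in_elt fs c.
exists [:: s] => G uG sG; rewrite [colim_in _]zE.
have cE t :
    free_coord t x (free_in s x z) = mcomp (free_coord t) (free_in s) x z by [].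
rewrite (bigD1_seq s) //=; last by apply: sG; rewrite mem_head.
rewrite cE free_inK big1 ?addr0 // => t ts.
by rewrite cE free_coord_in // linear0.
Qed.

End FreeModule.

(** * Indecomposable projectives *)

Section Projectives.
Variables (k : fieldType) (d : Order.disp_t) (S : porderType d).

Lemma maximal_in_seq (X : eqType) (g : X -> S) (F : seq X) : F != [::] ->
  exists2 s, s \in F & forall t, t \in F -> (g s <= g t)%O -> g s = g t.
Proof.
elim: F => // u F IH _; have [->|/IH [s sF s_max]] := eqVneq F [::].
  by exists u; rewrite ?mem_head // => t; rewrite inE => /eqP ->.
have [le_su|nle] := boolP (g s <= g u)%O; last first.
  exists s => [|t]; first by rewrite inE sF orbT.
  by rewrite inE => /predU1P [-> le|/s_max //]; rewrite le in nle.
exists u => [|t]; first exact: mem_head.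
rewrite inE => /predU1P [-> //|tF] le_ut.
apply: le_anti; rewrite le_ut /=.
by rewrite -(s_max t tF (le_trans le_su le_ut)).
Qed.

(** A morphism to a principal upset that is nonzero at [a] hits the generator up
    to a scalar, hence splits. *)
Lemma upset_retract a (M : Rep k S) (g : mor M (upset_pmod k a)) (v : M a) :
  g a v <> 0 -> exists f, mcomp g f = idm (upset_pmod k a).
Proof.
set c := line_if_map k (a <= a)%O true (g a v) => gv0.
have c0 : (c : k) != 0.
  apply/eqP => c0; apply: gv0; rewrite [g a v]line_ifE -/c.
  by rewrite (_ : c = 0 :> k^o) // linear0.
exists (upset_hom ((c : k)^-1 *: v)); apply: upset_hom_ext.
rewrite pmod_mcompE upset_hom_gen linearZ (upset_eltE (lexx a) (g a v)) -/c.
by rewrite pmod_id [LHS]scalerA mulVf ?scale1r.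
Qed.

Lemma projective_upset_retract (M : Rep k S) : projective M -> ~ is_zero M ->
  exists (a : S) (f : mor (upset_pmod k a) M) (g : mor M (upset_pmod k a)),
    mcomp g f = idm (upset_pmod k a).
Proof.
move=> proj_M M0; apply: contrapT => noret; apply: M0.
(* the free module with one basis element for each element of [M] *)
pose X : choiceType := {a : S & M a}; pose deg (s : X) := tag s.
pose cover : mor (free_pmod k deg) M := free_hom (fun s => tagged s).
have cover_surj : pointwise_surj cover.
  move=> x v; exists (free_gen k deg (Tagged (fun a => M a : Type) v)).
  by have := @free_hom_gen k d S X deg M (fun s => tagged s)
    (Tagged (fun a => M a : Type) v).
have [sec secK] := proj_M _ _ _ (idm M) (pointwise_surj_epi cover_surj).
(* no coordinate of the section has a nonzero value in its own degree *)
have sec0 s x (v : M x) : deg s = x -> free_coord k deg s x (sec x v) = 0.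
  move=> e; case: _ / e in v *; apply: contrapT => sv0; apply: noret.
  have [f fK] := upset_retract (g := mcomp (free_coord k deg s) sec) sv0.
  by exists (deg s), f, (mcomp (free_coord k deg s) sec).
move=> x v; pose y := sec x v.
have [F yE] := free_span y.
pose c s := free_coord k deg s x y.
have cover_y : cover x y = v.
  by have /(congr1 (fun h : mor M M => h x v)) := secK.
rewrite -cover_y yE big_seq big1 ?linear0 // => s sF.
suff cs0 : c s = 0 by rewrite -/(c s) cs0 linear0.
move: s sF; suff /eqP F0 : [seq s <- F | c s != 0] == [::].
  move=> s sF; apply/eqP; apply: contraT => cs.
  by have := mem_filter (fun s => c s != 0) s F; rewrite F0 cs sF.
(* a nonzero coordinate of maximal degree *)
apply: contraT => /(maximal_in_seq deg) [s].
rewrite mem_filter => /andP [cs0 sF] s_max; case/eqP: cs0.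
(* the section of the cover of [y] is [y] itself *)
pose e := mcomp (free_coord k deg s) (mcomp sec cover).
have -> : c s = \sum_(t <- F) e x (free_in k deg t x (c t)).
  by rewrite -(linear_sum (e x)) -yE !pmod_mcompE cover_y.
rewrite big_seq big1 // => t tF.
have [ct0|ct0] := eqVneq (c t) 0; first by rewrite -/(c t) ct0 !linear0.
have le_tx : (deg t <= x)%O by apply: contraNT ct0 => /(upset_elt0 (c t)) ->.
pose h := mcomp e (free_in k deg t).
suff h0 : h = zero_hom _ _.
  by have /(congr1 (fun h : mor _ (upset_pmod k (deg s)) => h x (c t))) := h0.
(* at the generator, either [deg t] is not in the upset of [deg s], or both
   degrees agree by maximality and [sec0] applies *)
apply: upset_hom_ext.
case le_st: (deg s <= deg t)%O; last by rewrite [LHS]upset_elt0 // le_st.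
rewrite !pmod_mcompE.
by apply/sec0/(s_max _ _ le_st); rewrite mem_filter ct0.
Qed.

Lemma projective_indecomposable_upset (M : Rep k S) :
  projective M -> indecomposable M -> exists a, isomorphic M (upset_pmod k a).
Proof.
move=> proj_M M_indec; case: (M_indec) => M0 _.
have [a [f [g gf]]] := projective_upset_retract proj_M M0.
exists a; apply: (retract_indecomposable gf M_indec).
by case: (upset_indecomposable k a).
Qed.

End Projectives.

(** * Interior systems *)

Section InteriorSystems.
Variables (k : fieldType) (d : Order.disp_t) (P : porderType d) (Q : {pred P}).
Hypothesis intQ : interior_system Q.
Let fl := floor intQ.
Let inc (y : subposet Q) : P := val y.

Lemma floor_ge (y : subposet Q) x : (val y <= x)%O -> (y <= fl x)%O.
Proof. by have [_ _ fl_max] := floorP intQ x; apply/fl_max/valP. Qed.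

Lemma floor_le x : (inc (fl x) <= x)%O.
Proof. by case: (floorP intQ x). Qed.

Lemma val_homo : {homo inc : x y / (x <= y)%O}.
Proof. by []. Qed.

Let pullF := pull k (@floor_homo _ _ _ intQ).

(** For an interior system, induction is restriction along the floor map: the
    colimit defining it at [x] is over the elements of [Q] below [x], of which
    [floor x] is the largest. *)
Section IndFloor.
Variable N : Rep k (subposet Q).

(** Transposed across the inclusion, this becomes the isomorphism [ind_floor]. *)
Definition ind_floor_in : mor N (pull_ob val_homo (pullF N)) :=
  @PmodHom k d _ N (pull_ob val_homo (pullF N))
    (fun y => pmod_map N (floor_ge (lexx (val y))))
    (fun x y le_xy v =>
       let le_xfy := le_trans le_xy (floor_ge (lexx (val y))) in
       etrans (pmod_comp _ _ le_xfy v) (esym (pmod_comp _ _ le_xfy v))).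

Definition ind_floor : mor (Ind Q k N) (pullF N) := lan_desc ind_floor_in.

Lemma floor_ind_nat x y (le_xy : (x <= y)%O) v :
  lan_in N (floor_le y : fl y \in down_fiber inc y)
    (pmod_map (pullF N) le_xy v) =
  pmod_map (Ind Q k N) le_xy
    (lan_in N (floor_le x : fl x \in down_fiber inc x) v).
Proof.
have fy : fl x \in down_fiber inc y by apply: le_trans le_xy; apply: floor_le.
by rewrite [LHS](lan_in_map fy) [RHS](lan_map_in _ _ fy).
Qed.

(** The inverse of [ind_floor]: the coprojection at the largest element *)
Definition floor_ind : mor (pullF N) (Ind Q k N) :=
  @PmodHom k d P (pullF N) (Ind Q k N)
    (fun x => lan_in N (floor_le x : fl x \in down_fiber inc x)) floor_ind_nat.

Lemma ind_floor_inE x (y : subposet Q) (le_yx : y \in down_fiber inc x) v :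
  ind_floor x (lan_in N le_yx v) = pmod_map N (floor_ge le_yx) v.
Proof. by rewrite [LHS]lan_desc_in; apply: (@pmod_comp _ _ _ N). Qed.

Lemma floor_indK : mcomp ind_floor floor_ind = idm (pullF N).
Proof.
by apply: pmod_hom_ext => x v; rewrite pmod_mcompE ind_floor_inE pmod_id.
Qed.

Lemma ind_floorK : mcomp floor_ind ind_floor = idm (Ind Q k N).
Proof.
apply: pmod_hom_ext => x; apply: lan_ext => y fy v.
rewrite pmod_mcompE ind_floor_inE; exact: (lan_in_map fy).
Qed.

End IndFloor.

Lemma floor_ind_natural N N' (h : mor N N') :
  mcomp (floor_ind N') (fmap pullF h) = mcomp (fmap (Ind Q k) h) (floor_ind N).
Proof.
by apply: pmod_hom_ext => x v; rewrite !pmod_mcompE [RHS]lan_hom_at_in.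
Qed.

Lemma ind_floor_natural N N' (h : mor N N') :
  mcomp (ind_floor N') (fmap (Ind Q k) h) = mcomp (fmap pullF h) (ind_floor N).
Proof.
rewrite -[LHS]mcomp_idr -(ind_floorK N) -!mcompA (mcompA (fmap _ h)).
by rewrite -floor_ind_natural !mcompA floor_indK mcomp_idl.
Qed.

Definition cont_ind_adjunction : adjunction (Cont intQ k) (Ind Q k) :=
  iso_adjunction (lan_adjunction k (@floor_homo _ _ _ intQ))
    floor_indK ind_floorK floor_ind_natural.

Lemma ind_exact : exact_functor (Ind Q k).
Proof.
split=> [|M N L g h gh]; first exact: lan_additive.
have [g_inj exact_gh h_surj] :=
  (pull_exact k (@floor_homo _ _ _ intQ)).2 _ _ _ _ _ gh.
have FI K x v : floor_ind K x (ind_floor K x v) = v.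
  by have /(congr1 (fun h : mor (Ind Q k K) (Ind Q k K) => h x v)) :=
    ind_floorK K.
have IF K x v : ind_floor K x (floor_ind K x v) = v.
  by have /(congr1 (fun h : mor (pullF K) (pullF K) => h x v)) := floor_indK K.
have nat K K' (e : mor K K') x v :
    ind_floor K' x (fmap (Ind Q k) e x v) = fmap pullF e x (ind_floor K x v).
  by have /(congr1 (fun h : mor (Ind Q k K) (pullF K') => h x v)) :=
    ind_floor_natural e.
have nat' K K' (e : mor K K') x v :
    fmap (Ind Q k) e x (floor_ind K x v) = floor_ind K' x (fmap pullF e x v).
  by have /(congr1 (fun h : mor (pullF K) (Ind Q k K') => h x v)) :=
    floor_ind_natural e.
split=> x.
- move=> v w vw; rewrite -[v]FI -[w]FI; congr (floor_ind _ _ _).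
  by apply: g_inj; rewrite -!nat vw.
- move=> v; rewrite -[v]FI nat'; split.
    move/(congr1 (ind_floor L x)); rewrite IF linear0 => /exact_gh [u <-].
    by exists (floor_ind M x u); rewrite nat'.
  case=> u /(congr1 (ind_floor N x)); rewrite nat IF => <-.
  rewrite (_ : fmap pullF h x _ = 0) ?linear0 //.
  by apply/exact_gh; exists (ind_floor M x u).
- move=> w; have [v vw] := h_surj x (ind_floor L x w).
  by exists (floor_ind N x v); rewrite nat' [fmap pullF h x v]vw FI.
Qed.

Lemma cont_ind_id :
  naturally_isomorphic (comp_functor (Cont intQ k) (Ind Q k))
    (id_functor (Rep k (subposet Q))).
Proof.
exists (fun N => lan_desc (f_homo := @floor_homo _ _ _ intQ) (ind_floor N)).
(* the counit on an element [v] of [N y], placed over [a] and then over [x] *)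
have epsE (N : Rep k (subposet Q)) x a (fa : a \in down_fiber fl x)
    (y : subposet Q) (fy : y \in down_fiber inc a) (v : N y)
    (le_yx : (y <= x)%O) :
    lan_desc (f_homo := @floor_homo _ _ _ intQ) (ind_floor N) x
      (lan_in (Ind Q k N) fa (lan_in N fy v)) = pmod_map N le_yx v.
  rewrite [LHS]lan_desc_in ind_floor_inE; exact: (@pmod_comp _ _ _ N).
split=> [N N' h|N].
  apply: lan_hom_eq => a v; rewrite [RHS]pmod_mcompE lan_desc_unit.
  transitivity (lan_desc (f_homo := @floor_homo _ _ _ intQ) (ind_floor N')
    (fl a) (lan_unit fl (Ind Q k N') a (fmap (Ind Q k) h a v))).
    by congr (lan_desc _ _ _); apply: lan_hom_unit.
  rewrite lan_desc_unit.
  by have /(congr1 (fun h : mor (Ind Q k N) (pullF N') => h a v)) :=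
    ind_floor_natural h.
have fl_val (y : subposet Q) : val y \in down_fiber fl y by apply: floor_le.
pose inv y : {linear N y -> Cont intQ k (Ind Q k N) y} :=
  lan_in (Ind Q k N) (fl_val y) \o lan_unit inc N y.
apply: (is_iso_pointwise (g := inv)) => x; last first.
  by move=> v; rewrite (epsE _ _ _ _ _ _ _ (lexx x)) pmod_id.
apply: (lan_ext (g := inv x \o lan_desc_at _ x) (h := idfun)) => a fa.
apply: (lan_ext (g := inv x \o lan_desc_at _ x \o lan_in (Ind Q k N) fa)
  (h := lan_in (Ind Q k N) fa)) => y fy v.
have le_yx : (y <= x)%O by apply: le_trans fa; apply: floor_ge.
rewrite [LHS]/= [lan_desc_at _ _ _](epsE _ _ _ _ _ _ _ le_yx) /=.
(* both sides are the class of the element [v] placed over [val y] *)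
have lan_yx : lan_unit inc N x (pmod_map N le_yx v) =
    pmod_map (Ind Q k N) (le_yx : (val y <= val x)%O) (lan_unit inc N y v).
  rewrite lan_unit_map.
  exact: (lan_in_map (le_yx : y \in down_fiber inc (val x))).
have fx : val y \in down_fiber fl x by apply: le_trans (le_yx); apply: floor_le.
rewrite lan_yx -(lan_unit_map (fy : y \in down_fiber inc a)).
by rewrite [LHS](lan_in_map fx) [RHS](lan_in_map fx).
Qed.

(** The right adjoint [Ind Q k] is the left adjoint of the restriction to [Q],
    hence preserves epimorphisms. *)
Lemma cont_projective (M : Rep k P) :
  projective M -> projective (Cont intQ k M).
Proof.
apply: (left_adjoint_projective cont_ind_adjunction) => N N' e.
exact: (left_adjoint_epi (lan_adjunction k val_homo)).
Qed.

Lemma cont_indecomposable (M : Rep k P) : projective M -> indecomposable M ->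
  indecomposable (Cont intQ k M).
Proof.
move=> proj_M /(projective_indecomposable_upset proj_M) [a Ma].
apply: indecomposable_isomorphic (upset_indecomposable k (fl a)).
apply: isomorphic_sym; apply: isomorphic_trans (functor_isomorphic _ Ma) _.
exact/lan_upset/floor_homo.
Qed.

End InteriorSystems.

Theorem proposition3p3 (k : fieldType) (d : Order.disp_t) (P : porderType d)
    (Q : {pred P}) (intQ : interior_system Q) :
  exists adj : adjunction (Cont intQ k) (Ind Q k),
  [/\ naturally_isomorphic (comp_functor (Cont intQ k) (Ind Q k))
        (id_functor (Rep k (subposet Q))),
      right_exact (Cont intQ k) /\ exact_functor (Ind Q k),
      (forall M : Rep k P, projective M -> projective (Cont intQ k M)) /\
      (forall M : Rep k P, projective M -> indecomposable M ->
         projective (Cont intQ k M) /\ indecomposable (Cont intQ k M))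
    & exists (fpC : forall M : Rep k P,
               finitely_presentable M -> finitely_presentable (Cont intQ k M))
             (fpI : forall N : Rep k (subposet Q),
               finitely_presentable N -> finitely_presentable (Ind Q k N))
             (adj_fp : adjunction
                (restrict_functor fpC : functor (fprep k P) (fprep k (subposet Q)))
                (restrict_functor fpI : functor (fprep k (subposet Q)) (fprep k P))),
        forall (M : fprep k P) (N : fprep k (subposet Q))
          (g : mor (Cont intQ k (sval M)) (sval N)),
          transpose adj_fp (c := M) (x := N) g = transpose adj g].
Proof.
exists (cont_ind_adjunction k intQ); split.
- exact: cont_ind_id.
- by split; [exact: lan_right_exact | exact: ind_exact].
- split=> M proj_M; first exact: cont_projective.
  by split; [exact: cont_projective | exact: cont_indecomposable].
exists (lan_finitely_presentable (floor_homo intQ)).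
exists (lan_finitely_presentable (@val_homo d P Q)).
by exists (restrict_adjunction _ _ (cont_ind_adjunction k intQ)).
Qed.
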